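(* Let $k$ be a field complete with respect to a non-archimedean absolute value $|\cdot|$, with valuation ring $\mathfrak o_k$. Let $\mathscr A$ be a finitely generated $\mathfrak o_k$-algebra containing $\mathfrak o_k$ as a subring, and $A:=\mathscr A\otimes_{\mathfrak o_k}k$. Let $\operatorname{Spec}(A)^{\mathrm{an}}_{\mathscr A}$ be the set of points $x$ of the Berkovich analytification $\operatorname{Spec}(A)^{\mathrm{an}}$ (multiplicative seminorms $|\cdot|_x$ on $A$ extending $|\cdot|$) such that $|a|_x\leq1$ for all $a\in\mathscr A$. Then $\{\alpha\in A\mid \alpha\text{ is integral over }\mathscr A\}=\bigcap_{x\in\operatorname{Spec}(A)^{\mathrm{an}}_{\mathscr A}}\{\alpha\in A\mid |\alpha|_x\leq1\}.$ *)

(* Defs.v *)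
From HB Require Import structures.
From mathcomp Require Import all_boot all_order all_algebra.
From mathcomp Require Import reals ring.
Set Implicit Arguments. Unset Strict Implicit. Unset Printing Implicit Defensive.
Import Order.TTheory GRing.Theory Num.Theory.
Local Open Scope ring_scope.

Record nonarch_abs (k : fieldType) (R : realType) := NonarchAbs {
  nabs :> k -> R;
  nabs_ge0 : forall x, 0 <= nabs x;
  nabs_eq0 : forall x, nabs x = 0 <-> x = 0;
  nabsM : forall x y, nabs (x * y) = nabs x * nabs y;
  nabs_ultra : forall x y, nabs (x + y) <= Num.max (nabs x) (nabs y) }.

Definition complete_abs (k : fieldType) (R : realType) (v : nonarch_abs k R) :=
  forall u : nat -> k,
    (forall e : R, 0 < e -> exists N : nat, forall m n : nat,
        (N <= m)%N -> (N <= n)%N -> v (u m - u n) < e) ->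
    exists l : k, forall e : R, 0 < e -> exists N : nat, forall n : nat,
        (N <= n)%N -> v (u n - l) < e.

Section ValuationRing.
Variables (k : fieldType) (R : realType) (v : nonarch_abs k R).

Lemma nabs1 : v 1 = 1.
Proof.
have h := nabsM v 1 1; rewrite mulr1 in h.
have nz : v 1 != 0 by apply/eqP => /(nabs_eq0 v)/eqP; rewrite oner_eq0.
by apply: (mulfI nz); rewrite -h mulr1.
Qed.

Lemma nabsN x : v (- x) = v x.
Proof.
have h := nabsM v (-1) (-1); rewrite mulrNN mulr1 nabs1 in h.
have hN1 : v (-1) = 1.
  have g := nabs_ge0 v (-1).
  have e : (v (-1) - 1) * (v (-1) + 1) = 0.
    by rewrite mulrDr !mulrBl -h; ring.
  have pos : v (-1) + 1 != 0 by rewrite gt_eqF // ltr_wpDl.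
  by move/eqP: e; rewrite mulf_eq0 (negbTE pos) orbF subr_eq0 => /eqP.
by rewrite -mulN1r nabsM hN1 mul1r.
Qed.

Definition ok_pred : {pred k} := fun x => v x <= 1.

Lemma ok_subring_closed : subring_closed ok_pred.
Proof.
split; rewrite /ok_pred ?unfold_in /=.
- by rewrite nabs1.
- move=> x y; rewrite ?unfold_in /= => hx hy; apply: le_trans (nabs_ultra v x (-y)) _.
  by rewrite ge_max hx nabsN hy.
- move=> x y; rewrite ?unfold_in /= => hx hy; rewrite nabsM.
  by rewrite -[1]mulr1; apply: ler_pM => //; apply: nabs_ge0.
Qed.

HB.instance Definition _ := GRing.isSubringClosed.Build k ok_pred
  ok_subring_closed.

Record ok := Ok { okval :> k; okvalP : okval \in ok_pred }.
HB.instance Definition _ := [isSub for okval].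
HB.instance Definition _ := [Choice of ok by <:].
HB.instance Definition _ := [SubChoice_isSubComNzRing of ok by <:].

End ValuationRing.
Arguments ok {k R} v.

Definition fin_gen_alg (S : comNzRingType) (B : comAlgType S) :=
  exists s : seq B, forall P : B -> Prop,
    P 1 -> (forall x, x \in s -> P x) ->
    (forall x y, P x -> P y -> P (x + y)) ->
    (forall x y, P x -> P y -> P (x * y)) ->
    (forall (c : S) x, P x -> P (c *: x)) ->
    forall x, P x.

(* (A, phi) is the base change  A = sA (x)_{o_k} k  of the o_k-algebra sA:
   phi : sA -> A is o_k-linear, and A is the localisation of sA at the
   nonzero elements of o_k (k = Frac(o_k)): every element of A is of the form
   c^-1 phi(a), and the kernel of phi is the o_k-torsion of sA. *)
Definition is_base_change (k : fieldType) (R : realType) (v : nonarch_abs k R)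
    (sA : comAlgType (ok v)) (A : comAlgType k) (phi : {rmorphism sA -> A}) :=
  [/\ forall (c : ok v) (a : sA), phi (c *: a) = (c : k) *: phi a,
      forall x : A, exists (c : ok v) (a : sA), (c : k) != 0 /\ (c : k) *: x = phi a
    & forall a : sA, phi a = 0 -> exists c : ok v, (c : k) != 0 /\ c *: a = 0].

Definition berkovich_point (k : fieldType) (R : realType) (v : nonarch_abs k R)
    (A : comAlgType k) (s : A -> R) :=
  [/\ forall x, 0 <= s x,
      forall x y, s (x + y) <= s x + s y,
      forall x y, s (x * y) = s x * s y
    & forall c : k, s (c%:A) = v c].

(* Main.v *)
Require Import Defs.
From HB Require Import structures.
From mathcomp Require Import all_boot all_order all_algebra.
From mathcomp Require Import boolp classical_sets.
From mathcomp Require Import reals ring zify.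
Set Implicit Arguments. Unset Strict Implicit. Unset Printing Implicit Defensive.
Import Order.TTheory GRing.Theory Num.Theory.
Local Open Scope ring_scope.

(* If al is not integral over the image of sA, map A to a field K by a prime
   avoiding all monic polynomials in al; then be = 1/al is not a unit of the
   finitely generated ring C = sA[be] in K, and be divides some pi in the
   maximal ideal of o_k.  Take a prime Q of C minimal over be and a valuation
   ring V of K centered at Q, so that V meets k in o_k.  If some power of be
   lies in pi V, then y |-> inf |c|^(1/n) over y^n \in c V is a point of the
   analytification that exceeds 1 at al.
   Otherwise be is infinitely close to the units.  Let F be a maximal
   residually transcendental extension of k generated by generators of C; since
   pi / be has a pole on the line over F with coordinate be, it is not integral
   over that line.  Adding the remaining generators one at a time, some
   generator x is not in the localised integral closure O of the previous ring
   although x is residually algebraic and Q is isolated in its fibre.  This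
   contradicts Zariski's Main Theorem for O[x] (Peskine's conductor argument). *)

(** * Zorn's lemma, subrings and primes *)

(** The obstacle is the rank of V. A valuation ring that separates [al] from the ring always exists,
    but a Berkovich point is real-valued: when pi is divisible in V by every power of be, the
    infimum gives [al] the value 1 and nothing is gained. That case must be shown not to occur, and
    this is where finite generation enters. Minimality of Q over be provides the leverage: each f in
    Q satisfies g f^n = be s with g outside Q. For f the value at a generator x of a polynomial that
    witnesses its residual algebraicity, this becomes an equation g H(x) = be s with H over O, from
    which the conductor argument derives that g lies in Q after all. All rings are predicates on one
    field K. Integral closure is an intersection of valuation rings, so integrality is checked in
    one valuation ring at a time, and localisation at the centre of V is expressed by a multiplier
    outside [mx V]. *)

Lemma zorn_above (T : Type) (good : T -> Prop) (R : T -> T -> Prop) (t0 : T) :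
    (forall t, R t t) -> (forall r s t, R r s -> R s t -> R r t) -> good t0 ->
    (forall A : T -> Prop, (exists a, A a) -> (forall a, A a -> good a) ->
       (forall a b, A a -> A b -> R a b \/ R b a) ->
       exists t, good t /\ forall a, A a -> R a t) ->
  exists t, [/\ good t, R t0 t & forall s, good s -> R t s -> R s t].
Proof.
move=> Rxx Rtr g0 ub; pose S := {t : T | good t /\ R t0 t}.
pose RS (a b : S) := `[< R (sval a) (sval b) >].
pose s0 : S := exist _ t0 (conj g0 (Rxx t0)).
have [|||t tmax] := @ZL_preorder S s0 RS.
- by move=> t; apply/asboolP.
- by move=> r s t /asboolP rs /asboolP st; apply/asboolP/(Rtr _ _ _ rs).
- move=> A totA; have [[a Aa]|nA] := pselect (exists a, A a); last first.
    by exists s0 => s As; case: nA; exists s.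
  have [|||t [gt tub]] := ub (fun x => exists2 s, A s & sval s = x).
  + by exists (sval a), a.
  + by move=> _ [s _ <-]; case: (svalP s).
  + move=> _ _ [s As <-] [s' As' <-].
    by have [/asboolP|/asboolP] := totA _ _ As As'; [left|right].
  have t0t : R t0 t.
    by apply: (Rtr _ (sval a)); [case: (svalP a)|apply: tub; exists a].
  exists (exist _ t (conj gt t0t)) => s As; apply/asboolP/tub.
  by exists s.
exists (sval t); have [gt t0t] := svalP t; split=> // s gs ts.
have t0s := Rtr _ _ _ t0t ts.
by have /asboolP := tmax (exist _ s (conj gs t0s)) (asboolT ts).
Qed.

Section Closed.
Variable R : nzRingType.

Definition apred (D : R -> Prop) : {pred R} := fun x => `[< D x >].

(** The closure proof is a dummy argument, so that the canonical instance can recover it from the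
    predicate. *)
Definition subring_pred D of subring_closed (apred D) := apred D.
HB.instance Definition _ D (h : subring_closed (apred D)) :=
  GRing.isSubringClosed.Build R (subring_pred h) h.

Lemma subringP (D : R -> Prop) : D 1 -> (forall x y, D x -> D y -> D (x - y)) ->
    (forall x y, D x -> D y -> D (x * y)) ->
  exists S : subringClosed R, forall x, x \in S <-> D x.
Proof.
move=> D1 DB DM; have h : subring_closed (apred D).
  split; first exact/asboolP.
  - by move=> x y /asboolP ? /asboolP ?; apply/asboolP/DB.
  - by move=> x y /asboolP ? /asboolP ?; apply/asboolP/DM.
by exists (GRing.SubringClosed.clone R (subring_pred h) _) => x; split=> [/asboolP|?]; last apply/asboolP.
Qed.

Inductive gen (X : R -> Prop) : R -> Prop :=
| gen_in x of X x : gen X x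
| gen1 : gen X 1
| genB x y of gen X x & gen X y : gen X (x - y)
| genM x y of gen X x & gen X y : gen X (x * y).

Fact gen_closed X : subring_closed (apred (gen X)).
Proof.
split; first exact/asboolP/gen1.
- by move=> x y /asboolP ? /asboolP ?; apply/asboolP/genB.
- by move=> x y /asboolP ? /asboolP ?; apply/asboolP/genM.
Qed.
Definition genr (X : R -> Prop) : {pred R} := apred (gen X).
HB.instance Definition _ X := GRing.isSubringClosed.Build R (genr X) (gen_closed X).

Lemma mem_gen X x : X x -> x \in genr X. Proof. by move=> ?; apply/asboolP/gen_in. Qed.

Lemma gen_sub X (S : subringClosed R) :
  (forall x, X x -> x \in S) -> {subset genr X <= S}.
Proof.
move=> XS x /asboolP; elim=> {x} [x /XS//||x y _ xS _ yS|x y _ xS _ yS].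
- exact: rpred1.
- exact: rpredB.
- exact: rpredM.
Qed.

End Closed.

Section Ideal.
Variable R : comNzRingType.

Lemma eval_ring (D : subringClosed R) x :
  exists S : subringClosed R,
    forall z, z \in S <-> exists2 P : {poly R}, P \is a polyOver D & P.[x] = z.
Proof.
apply: subringP.
- by exists 1; rewrite ?rpred1 ?hornerC.
- by move=> _ _ [P PD <-] [Q QD <-]; exists (P - Q); rewrite ?rpredB ?hornerE.
- by move=> _ _ [P PD <-] [Q QD <-]; exists (P * Q); rewrite ?rpredM ?hornerM.
Qed.

Definition ideal_of (D : subringClosed R) (I : R -> Prop) :=
  [/\ I 0, forall x, I x -> x \in D, forall x y, I x -> I y -> I (x + y)
    & forall a x, a \in D -> I x -> I (a * x)].

Lemma ideal_sum D I (h : ideal_of D I) (J : Type) (r : seq J) (P : pred J) (F : J -> R) :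
  (forall j, P j -> I (F j)) -> I (\sum_(j <- r | P j) F j).
Proof. by case: h => I0 _ ID _ FI; apply: big_ind. Qed.

Definition prime_of (D : subringClosed R) (I : R -> Prop) :=
  [/\ ideal_of D I, ~ I 1 &
      forall a b, a \in D -> b \in D -> I (a * b) -> I a \/ I b].

(* The complement of P is a maximal multiplicative set containing M and
   avoiding J, whence the last clause: P is minimal over J. *)
Lemma prime_avoid (D : subringClosed R) (J M : R -> Prop) :
    ideal_of D J -> M 1 -> (forall x, M x -> x \in D) ->
    (forall x y, M x -> M y -> M (x * y)) -> (forall x, M x -> ~ J x) ->
  exists P, [/\ prime_of D P, forall x, J x -> P x, forall x, M x -> ~ P x
    & forall x, P x -> exists u n, [/\ u \in D, ~ P u & J (u * x ^+ n)]].
Proof.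
move=> [J0 JD JA JM] M1 MD MM MJ.
pose good N := [/\ N 1, forall x, N x -> x \in D,
  forall x y, N x -> N y -> N (x * y) & forall x, N x -> ~ J x].
pose le (A B : R -> Prop) := forall x, A x -> B x.
have [||||N [[N1 ND NM NJ] MN Nmax]] := @zorn_above _ good le M.
- by move=> A.
- by move=> A B C AB BC x /AB/BC.
- by split.
- move=> F [A0 FA0] Fg Ft; exists (fun x => exists2 A, F A & A x); split; last first.
    by move=> A FA x Ax; exists A.
  split.
  + by exists A0 => //; case: (Fg _ FA0).
  + by move=> x [A /Fg[_ AD _ _] /AD].
  + move=> x y [A FA Ax] [B FB By].
    have [AB|BA] := Ft _ _ FA FB.
      by exists B => //; case: (Fg _ FB) => _ _ BM _; apply: BM => //; apply: AB.
    by exists A => //; case: (Fg _ FA) => _ _ AM _; apply: AM => //; apply: BA.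
  + by move=> x [A /Fg[_ _ _ AJ] /AJ].
pose P x := x \in D /\ ~ N x.
(* By maximality of N, the multiplicative set generated by N and x meets J as soon as x lies outside
   N. *)
have key x : x \in D -> (exists u n, N u /\ J (u * x ^+ n)) <-> ~ N x.
  move=> xD; split=> [[u [n [Nu Jux]]] Nx|nNx].
    apply: (NJ _ _ Jux); elim: n {Jux} => [|n IHn]; first by rewrite expr0 mulr1.
    by rewrite exprSr mulrA; apply: NM.
  apply: contrapT => nex; apply: nNx.
  apply: (Nmax (fun z => exists u n, N u /\ z = u * x ^+ n)); last first.
  - by exists 1, 1%N; rewrite mul1r expr1.
  - by move=> u Nu; exists u, 0%N; rewrite expr0 mulr1.
  split.
  - by exists 1, 0%N; rewrite mul1r.
  - by move=> _ [u [n [/ND uD ->]]]; rewrite rpredM ?rpredX.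
  - move=> _ _ [u [n [Nu ->]]] [w [m [Nw ->]]].
    by exists (u * w), (n + m)%N; split; [apply: NM|rewrite exprD mulrACA].
  - by move=> _ [u [n [Nu ->]]] Jz; apply: nex; exists u, n.
exists P; split.
- split.
  + split=> //.
    * by split; [exact: rpred0|move/NJ].
    * by move=> x [].
    * move=> x y [xD nNx] [yD nNy]; split; first exact: rpredD.
      have [u [n [Nu Ju]]] := (key _ xD).2 nNx.
      have [w [m [Nw Jw]]] := (key _ yD).2 nNy.
      apply/key; first exact: rpredD.
      exists (u * w), (n + m)%N; split; first exact: NM.
      rewrite exprDn mulr_sumr; apply: (@ideal_sum D) => // i _.
      have [uD wD] := (ND _ Nu, ND _ Nw).
      (* In each binomial term either the exponent of x is at least n or that of y is at least m. *)
      rewrite -mulr_natr; have [le_im|lt_mi] := leqP i m.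
        have -> : u * w * (x ^+ (n + m - i) * y ^+ i * 'C(n + m, i)%:R) =
            w * y ^+ i * x ^+ (m - i) * 'C(n + m, i)%:R * (u * x ^+ n).
          by rewrite -addnBA // exprD; ring.
        by apply: JM => //; rewrite !rpredM ?rpredX ?rpred_nat.
      have -> : u * w * (x ^+ (n + m - i) * y ^+ i * 'C(n + m, i)%:R) =
          u * x ^+ (n + m - i) * y ^+ (i - m) * 'C(n + m, i)%:R * (w * y ^+ m).
        have -> : y ^+ i = y ^+ (i - m) * y ^+ m by rewrite -exprD subnK // ltnW.
        by ring.
      by apply: JM => //; rewrite !rpredM ?rpredX ?rpred_nat.
    * move=> a x aD [xD nNx]; split; first exact: rpredM.
      have [u [n [Nu Ju]]] := (key _ xD).2 nNx.
      apply/key; first exact: rpredM.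
      by exists u, n; split=> //; rewrite exprMn mulrCA; apply: JM => //; apply: rpredX.
  + by case.
  + move=> a b aD bD [_ nNab]; have [Na|] := pselect (N a); last by left.
    by right; split=> // Nb; apply/nNab/NM.
- by move=> x Jx; split; [apply: JD|move/NJ].
- by move=> x /MN Nx [_].
- move=> x [xD nNx]; have [u [n [Nu Ju]]] := (key _ xD).2 nNx.
  by exists u, n; split=> //; [apply: ND|case].
Qed.

End Ideal.

(** * Valuation rings *)

Section Valuation.
Variable K : fieldType.
Implicit Types (D : subringClosed K) (z : K).

Definition is_valring D := forall z, z != 0 -> (z \in D) || (z^-1 \in D).

Record valring := Valring {
  vring :> subringClosed K;
  valringP : is_valring vring }.
Implicit Types Y : valring.

(* The maximal ideal of Y; z \in Y is automatic, see mx_in. *)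
Definition mx Y z := (z == 0) || (z^-1 \notin Y).

Lemma mx0 Y : mx Y 0. Proof. by rewrite /mx eqxx. Qed.

Lemma mx1 Y : mx Y 1 = false.
Proof. by rewrite /mx oner_eq0 invr1 rpred1. Qed.

Lemma mx_in Y z : mx Y z -> z \in Y.
Proof.
rewrite /mx; have [->|z0] := eqVneq z 0; first by rewrite rpred0.
by move=> /= zN; have := valringP Y z0; rewrite (negbTE zN) orbF.
Qed.

Lemma mx_unit Y z : ~~ mx Y z -> z != 0 /\ z^-1 \in Y.
Proof. by rewrite negb_or negbK => /andP[]. Qed.

Lemma mxMl Y a z : a \in Y -> mx Y z -> mx Y (a * z).
Proof.
move=> aY; rewrite /mx mulf_eq0; have [//|a0] := eqVneq a 0.
have [//|z0] := eqVneq z 0; rewrite /= invfM; apply: contra => h.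
by rewrite -[z^-1](mulVKf a0) rpredM.
Qed.

Lemma mxMr Y a z : a \in Y -> mx Y z -> mx Y (z * a).
Proof. by rewrite mulrC; apply: mxMl. Qed.

Lemma mxMP Y a b : a \in Y -> b \in Y -> mx Y (a * b) = mx Y a || mx Y b.
Proof.
move=> aY bY; apply/idP/idP; last first.
  by case/orP => ?; [apply: mxMr|apply: mxMl].
have [//|/mx_unit[a0 aV]] := boolP (mx Y a).
by move=> /(mxMl aV); rewrite mulKf.
Qed.

Lemma mxXP Y a n : a \in Y -> mx Y (a ^+ n) = (0 < n)%N && mx Y a.
Proof.
move=> aY; elim: n => [|n IHn]; first by rewrite expr0 mx1.
by rewrite exprS mxMP ?rpredX // IHn; case: (mx Y a); rewrite ?andbF.
Qed.

Lemma mxD Y a b : mx Y a -> mx Y b -> mx Y (a + b).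
Proof.
wlog : a b / b == 0 \/ a / b \in Y => [th ma mb|].
  have [b0|b0] := eqVneq b 0; first by apply: th => //; left; apply/eqP.
  have [a0|a0] := eqVneq a 0; first by rewrite addrC; apply: th => //; left; apply/eqP.
  have /orP[h|h] := valringP Y (mulf_neq0 a0 (invr_neq0 b0)).
    by apply: th => //; right.
  by rewrite addrC; apply: th => //; right; rewrite invfM invrK mulrC in h.
move=> [/eqP->|abY] ma mb; first by rewrite addr0.
have [b0|b0] := eqVneq b 0; first by rewrite b0 addr0.
have -> : a + b = (a / b + 1) * b by rewrite mulrDl mul1r divfK.
by apply: mxMl => //; rewrite rpredD ?rpred1.
Qed.

Lemma mxN Y a : mx Y a -> mx Y (- a).
Proof. by rewrite -mulN1r; apply: mxMl; rewrite rpredN rpred1. Qed.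

Lemma mx_sum Y (J : Type) (r : seq J) (P : pred J) (F : J -> K) :
  (forall j, P j -> mx Y (F j)) -> mx Y (\sum_(j <- r | P j) F j).
Proof. by move=> h; apply: (big_ind (mx Y)) => //; [exact: mx0|exact: mxD]. Qed.

Section Domination.
Variables (D : subringClosed K) (M : K -> Prop).
Hypotheses (Mid : ideal_of D M) (M1 : ~ M 1).

Let overM (P : {poly K}) := forall i, M P`_i.

(** The usual argument divides by 1 - Q_0, a unit of a local ring. Here 1 is written as Q_0 + (1 -
    Q_0) P(z), and the relation for 1/z turns (1 - Q_0) z^(n+1) into a combination of lower powers;
    so M only has to be an ideal. *)
Lemma unit_relation_lower z n (P Q : {poly K}) : z != 0 -> overM P -> overM Q ->
  (size P <= n.+2)%N -> (size Q <= n.+2)%N -> P.[z] = 1 -> Q.[z^-1] = 1 ->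
  exists P', [/\ overM P', (size P' <= n.+1)%N & P'.[z] = 1].
Proof.
case: (Mid) => M0 MD MA MM z0 PM QM sP sQ Pz Qz.
pose P' := (Q`_0)%:P + (1 - Q`_0) *: (P - P`_n.+1 *: 'X^(n.+1)) +
  \sum_(i < n.+1) (P`_n.+1 * Q`_i.+1) *: 'X^(n - i).
have oQ0 : 1 - Q`_0 \in D by rewrite rpredB ?rpred1 ?MD.
have cP i : (P - P`_n.+1 *: 'X^(n.+1))`_i = if (i <= n)%N then P`_i else 0.
  rewrite coefB coefZ coefXn; case: (ltngtP i n.+1) => hi.
  - by rewrite -ltnS hi mulr0 subr0.
  - by rewrite nth_default ?(leq_trans sP) // mulr0 subr0 leqNgt (ltnW hi).
  - by rewrite hi mulr1 subrr ltnn.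
exists P'; split.
- move=> i; rewrite !coefD coefC coefZ cP coef_sum; apply: (MA); first apply: (MA).
  + by case: eqP.
  + by case: ifP => _; rewrite ?mulr0 //; apply: MM.
  + apply: (ideal_sum Mid) => j _; rewrite coefZ coefXn mulrC.
    by apply: (MM); [exact: rpred_nat|apply: MM => //; exact: MD].
- apply/leq_sizeP => i ni; rewrite !coefD coefC coefZ cP coef_sum.
  rewrite (leqNgt i n) ni /= mulr0 addr0 big1 => [|j _].
    by case: i ni => // i _; rewrite addr0.
  rewrite coefZ coefXn; case: eqP => [e|]; last by rewrite mulr0.
  by move: ni; rewrite e ltnNge leq_subr.
- have e (i : 'I_n.+1) : ((P`_n.+1 * Q`_i.+1) *: 'X^(n - i)).[z] =
      P`_n.+1 * z ^+ n.+1 * (Q`_i.+1 * z^-1 ^+ i.+1).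
    by rewrite !hornerE -subSS exprB ?unitfE ?ltn_ord // exprVn mulrACA mulrA.
  rewrite /P' !hornerD hornerC hornerZ hornerD hornerN hornerZ hornerXn horner_sum.
  rewrite (eq_bigr _ (fun i _ => e i)).
  rewrite -mulr_sumr; have := Qz; rewrite (horner_coef_wide _ sQ) big_ord_recl.
  rewrite expr0 mulr1 => /(canRL (addKr _)) eQ.
  have -> : \sum_(i < n.+1) Q`_i.+1 * z^-1 ^+ i.+1 = - Q`_0 + 1 by rewrite -eQ.
  by rewrite Pz; ring.
Qed.

(** Exchanging z with its inverse, the larger of the two size bounds is always the one that
    drops. *)
Lemma unit_relations_absurd a b z (P Q : {poly K}) : z != 0 -> overM P -> overM Q ->
  (size P <= a)%N -> (size Q <= b)%N -> P.[z] = 1 -> Q.[z^-1] = 1 -> False.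
Proof.
move: {2}(a + b)%N (leqnn (a + b)) => N; elim: N a b z P Q => [|N IHN] a b z P Q.
  rewrite leqn0 addn_eq0 => /andP[/eqP-> _] _ _ _.
  by rewrite leqn0 size_poly_eq0 => /eqP-> _ /eqP; rewrite horner0 eq_sym oner_eq0.
wlog ab : a b z P Q / (b <= a)%N => [th|].
  have [ab|/ltnW ab] := leqP b a; first exact: th.
  move=> leN z0 PM QM sP sQ Pz Qz.
  by apply: (th b a z^-1 Q P); rewrite ?invrK ?invr_eq0 // addnC.
case: a ab => [|[|n]] ab leN z0 PM QM sP sQ Pz Qz.
- by move: Pz; have := sP; rewrite leqn0 size_poly_eq0 => /eqP-> /eqP;
    rewrite horner0 eq_sym oner_eq0.
- by apply: M1; move: Pz; rewrite (size1_polyC sP) hornerC => <-.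
- have [P' [P'M sP' P'z]] := unit_relation_lower z0 PM QM sP (leq_trans sQ ab) Pz Qz.
  by apply: (IHN n.+1 b z P' Q); rewrite // -ltnS.
Qed.

End Domination.

Lemma horner_over D (P : {poly K}) z : P \is a polyOver D -> z \in D -> P.[z] \in D.
Proof. by move=> ? ?; apply: rpred_horner. Qed.

(** Chevalley's extension theorem. In a maximal pair (E, N), an element z outside E forces N E[z] to
    contain 1, and this cannot happen both for z and for its inverse. *)
Lemma dominate (D : subringClosed K) (M : K -> Prop) : ideal_of D M -> ~ M 1 ->
  exists Y : valring, {subset D <= Y} /\ forall x, M x -> mx Y x.
Proof.
move=> Mid M1.
pose good (A : (K -> Prop) * (K -> Prop)) :=
  exists D : subringClosed K, [/\ forall x, x \in D <-> A.1 x, ideal_of D A.2 & ~ A.2 1].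
pose le (A B : (K -> Prop) * (K -> Prop)) :=
  (forall x, A.1 x -> B.1 x) /\ (forall x, A.2 x -> B.2 x).
have [||||[D1 N] [[E [ED Nid N1]] [DE MN] maxE]] :=
    @zorn_above _ good le (fun x => is_true (x \in D), M).
- by move=> A.
- by move=> A B C [AB1 AB2] [BC1 BC2]; split=> x; [move/AB1/BC1|move/AB2/BC2].
- by exists D.
- move=> F [A0 FA0] Fg Ft.
  pose B := (fun x => exists2 A, F A & A.1 x, fun x => exists2 A, F A & A.2 x) : (K -> Prop) * (K -> Prop).
  exists B; split; last by move=> A FA; split=> x Ax; exists A.
  have dir A A' : F A -> F A' -> exists C, [/\ F C, le A C & le A' C].
    move=> FA FA'; have [h|h] := Ft _ _ FA FA'.
      by exists A'; split=> //; split.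
    by exists A; split=> //; split.
  have [|||S SB] := @subringP K B.1.
  + by exists A0 => //; have [E [EA _ _]] := Fg _ FA0; apply/EA/rpred1.
  + move=> x y [A FA Ax] [A' FA' Ay]; have [C [FC [AC _] [A'C _]]] := dir _ _ FA FA'.
    exists C => //; have [E [EC _ _]] := Fg _ FC.
    by apply/EC/rpredB; apply/EC; [apply: AC|apply: A'C].
  + move=> x y [A FA Ax] [A' FA' Ay]; have [C [FC [AC _] [A'C _]]] := dir _ _ FA FA'.
    exists C => //; have [E [EC _ _]] := Fg _ FC.
    by apply/EC/rpredM; apply/EC; [apply: AC|apply: A'C].
  exists S; split=> //; last by move=> [A /Fg[E [_ _ nA1]] /nA1].
  split.
  + by exists A0 => //; have [E [_ [] //]] := Fg _ FA0.
  + move=> x [A FA Ax]; apply/SB; exists A => //.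
    by have [E [EA [_ h _ _] _]] := Fg _ FA; apply/EA/h.
  + move=> x y [A FA Ax] [A' FA' Ay]; have [C [FC [_ AC] [_ A'C]]] := dir _ _ FA FA'.
    exists C => //; have [E [EC [_ _ h _] _]] := Fg _ FC.
    by apply: h; [apply: AC|apply: A'C].
  + move=> a x /SB[A FA Aa] [A' FA' Ax]; have [C [FC [AC _] [_ A'C]]] := dir _ _ FA FA'.
    exists C => //; have [E [EC [_ _ _ h] _]] := Fg _ FC.
    by apply: h; [apply/EC/AC|apply: A'C].
move=> /= in ED DE MN maxE Nid N1.
have ext z : z \notin E -> exists P : {poly K}, (forall i, N P`_i) /\ P.[z] = 1.
  move=> zE; apply: contrapT => nP.
  have [S SE] := eval_ring E z.
  case: (Nid) => N0 NE NA NM.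
  have [||h _] := maxE (fun y => is_true (y \in S),
      fun y => exists P : {poly K}, (forall i, N P`_i) /\ P.[z] = y).
  - exists S; split=> //=.
    split.
    + by exists 0; split=> [i|]; rewrite ?coef0 ?horner0.
    + by move=> _ [P [PN <-]]; apply/SE; exists P => //; apply/polyOverP => i; apply: NE.
    + move=> _ _ [P [PN <-]] [Q [QN <-]]; exists (P + Q); split=> [i|]; last by rewrite hornerD.
      by rewrite coefD; apply: NA.
    + move=> _ _ /SE[Q /polyOverP QE <-] [P [PN <-]]; exists (Q * P).
      split=> [i|]; last by rewrite hornerM.
      by rewrite coefM; apply: (ideal_sum Nid) => j _; apply: NM.
  - split=> x /=.
    + by move=> /ED xE; apply/SE; exists x%:P; rewrite ?polyOverC ?hornerC.
    + by move=> Nx; exists x%:P; split=> [i|]; rewrite ?hornerC // coefC; case: eqP.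
  by case/negP: zE; apply/ED/h/SE; exists 'X; rewrite ?polyOverX ?hornerX.
have valE : is_valring E.
  move=> z z0; apply: contrapT => /negP; rewrite negb_or => /andP[zE zE'].
  have [P [PN Pz]] := ext _ zE; have [Q [QN Qz]] := ext _ zE'.
  exact: (unit_relations_absurd Nid N1 z0 PN QN (leqnn _) (leqnn _) Pz Qz).
exists (Valring valE); split=> [x /DE/ED //|x /MN Nx].
rewrite /mx; have [//|x0 /=] := eqVneq x 0; apply/negP => xV.
by case: Nid => _ _ _ NM; apply: N1; rewrite -(mulVf x0); apply: NM.
Qed.

(** Domination alone yields a centre that contains P. Localising at P first turns the elements of D
    outside P into units, so the centre on D is exactly P. *)
Lemma dominate_prime (D : subringClosed K) (P : K -> Prop) : prime_of D P ->
  exists Y : valring, {subset D <= Y} /\ forall x, x \in D -> (mx Y x <-> P x).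
Proof.
move=> [[P0 PD PA PM] P1 Pp].
have P00 b : ~ P b -> b != 0 by move=> nPb; apply/eqP => b0; apply: nPb; rewrite b0.
pose loc (Q : K -> Prop) y := exists a b, [/\ Q a, b \in D, ~ P b & y = a / b].
have PN b : P b -> P (- b) by rewrite -mulN1r; apply: PM; rewrite rpredN rpred1.
have PMn b c : b \in D -> c \in D -> ~ P b -> ~ P c -> ~ P (b * c).
  by move=> bD cD nb nc /(Pp _ _ bD cD)[].
have [|||S SE] := @subringP K (loc (fun x => is_true (x \in D))).
- by exists 1, 1; rewrite rpred1 divr1.
- move=> _ _ [a [b [aD bD nb ->]]] [a' [b' [a'D b'D nb' ->]]].
  exists (a * b' - a' * b), (b * b'); split; rewrite ?rpredB ?rpredM //; first exact: PMn.
  by have := P00 _ nb; have := P00 _ nb' => ? ?; field; apply/andP.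
- move=> _ _ [a [b [aD bD nb ->]]] [a' [b' [a'D b'D nb' ->]]].
  exists (a * a'), (b * b'); split; rewrite ?rpredM //; first exact: PMn.
  by rewrite invfM mulrACA.
have [||Y [SY mY]] := @dominate S (loc P).
- split.
  + by exists 0, 1; rewrite rpred1 mul0r.
  + by move=> _ [a [b [/PD aD bD nb ->]]]; apply/SE; exists a, b.
  + move=> _ _ [a [b [aD bD nb ->]]] [a' [b' [a'D b'D nb' ->]]].
    exists (b' * a + b * a'), (b * b'); split; rewrite ?rpredM //; last first.
    * by have := P00 _ nb; have := P00 _ nb' => ? ?; field; apply/andP.
    * exact: PMn.
    * by apply: PA; apply: (PM).
  + move=> _ _ /SE[a [b [aD bD nb ->]]] [a' [b' [a'D b'D nb' ->]]].
    exists (a * a'), (b * b'); split; rewrite ?rpredM //; first exact: PM; first exact: PMn.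
    by rewrite invfM mulrACA.
- move=> [a [b [Pa bD nb /eqP]]].
  by rewrite eq_sym -(divff (P00 _ nb)) (inj_eq (divIf (P00 _ nb))) => /eqP ab; apply: nb; rewrite -ab.
exists Y; split=> [x xD|x xD].
  by apply/SY/SE; exists x, 1; rewrite rpred1 divr1.
split=> [mx|Px]; last by apply: mY; exists x, 1; rewrite rpred1 divr1.
apply: contrapT => nPx; move: mx; rewrite /mx (negbTE (P00 _ nPx)) /= => /negP; apply.
by apply/SY/SE; exists 1, x; rewrite rpred1 div1r.
Qed.

End Valuation.

(** * Gauss's lemma and integral closure *)

Lemma uniform_bound (P : nat -> nat -> Prop) :
    (forall i m n, (m <= n)%N -> P i m -> P i n) -> (forall i, exists n, P i n) ->
  forall k, exists N, forall i, (i < k)%N -> P i N.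
Proof.
move=> Pm Pe; elim=> [|k [N PN]]; first by exists 0%N.
have [n Pn] := Pe k; exists (maxn N n) => i.
rewrite ltnS leq_eqVlt => /predU1P[->|/PN]; first exact: Pm (leq_maxr _ _) Pn.
exact: Pm (leq_maxl _ _).
Qed.

Section MonicDivision.
Variables (R : nzRingType) (D : subringClosed R).

Lemma monic_division (F P : {poly R}) :
    F \is monic -> F \is a polyOver D -> P \is a polyOver D ->
  exists Q S : {poly R}, [/\ Q \is a polyOver D, S \is a polyOver D,
    P = Q * F + S & (size S < size F)%N].
Proof.
move=> Fm FD; have F0 := monic_neq0 Fm.
move: {2}(size P) (leqnn (size P)) => n; elim: n P => [|n IHn] P sP PD.
  exists 0, P; rewrite rpred0 mul0r add0r; split=> //.
  by apply: leq_ltn_trans sP _; rewrite lt0n size_poly_eq0.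
have [lt|le] := ltnP (size P) (size F).
  by exists 0, P; rewrite rpred0 mul0r add0r.
pose T := lead_coef P *: 'X^(size P - size F).
have TD : T \is a polyOver D.
  by apply: polyOverZ; [apply: (polyOverP PD)|rewrite polyOverXn].
have [||Q [S [QD SD e sS]]] := IHn (P - T * F); last first.
- by exists (Q + T), S; rewrite rpredD // mulrDl addrAC -e subrK.
- by rewrite rpredB ?rpredM.
apply/leq_sizeP => i ni; rewrite coefB -scalerAl coefZ coefXnM.
have sF : (0 < size F)%N by rewrite lt0n size_poly_eq0.
case: ltnP => hi; first by lia.
have [Pi|Pi] := eqVneq i (size P).-1.
  have -> : (i - (size P - size F) = (size F).-1)%N by lia.
  by rewrite -lead_coefE (monicP Fm) mulr1 Pi -lead_coefE subrr.
have sPi : (size P <= i)%N by move/eqP: Pi => Pi; lia.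
have sFi : (size F <= i - (size P - size F))%N by lia.
by rewrite !nth_default // mulr0 subr0.
Qed.

End MonicDivision.

Section ValuationPolynomials.
Variable K : fieldType.
Implicit Types (Y : valring K) (p q : {poly K}).

Lemma monic_root_vring Y p y : p \is monic -> p \is a polyOver Y -> p.[y] = 0 -> y \in Y.
Proof.
move=> pm pY py; apply: contraT => yY.
have y0 : y != 0 by apply: contraNneq yY => ->; rewrite rpred0.
have yV : mx Y y^-1 by rewrite /mx invr_eq0 invrK yY orbT.
have [n sp] : exists n, size p = n.+1.
  by exists (size p).-1; rewrite prednK // lt0n size_poly_eq0 monic_neq0.
have pn : p`_n = 1 by rewrite -(monicP pm) lead_coefE sp.
suff : mx Y 1 by rewrite mx1.
have : p.[y] * y^-1 ^+ n = 0 by rewrite py mul0r.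
rewrite horner_coef sp big_ord_recr /= pn mul1r mulrDl exprVn divff ?expf_neq0 //.
rewrite addrC => /(canRL (addrK _)) ->; rewrite sub0r; apply: mxN.
rewrite mulr_suml; apply: mx_sum => i _.
rewrite -mulrA; apply: mxMl; first exact: (polyOverP pY).
have -> : y ^+ i / y ^+ n = y^-1 ^+ (n - i).
  have -> : y ^+ n = y ^+ (n - i) * y ^+ i by rewrite -exprD subnK // ltnW.
  by rewrite exprVn invfM mulrCA divff ?mulr1 ?expf_neq0.
by rewrite mxXP ?mx_in // subn_gt0 ltn_ord.
Qed.

(** Reduced modulo the maximal ideal, p and q start in degrees i and j, so their product starts in
    degree i + j. *)
Lemma unit_coef_mul Y p q i j :
    p \is a polyOver Y -> q \is a polyOver Y ->
    (forall k, (k < i)%N -> mx Y p`_k) -> ~~ mx Y p`_i ->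
    (forall k, (k < j)%N -> mx Y q`_k) -> ~~ mx Y q`_j ->
  ~~ mx Y (p * q)`_(i + j).
Proof.
move=> /polyOverP pY /polyOverP qY ip ni jq nj.
have lij : (i < (i + j).+1)%N by rewrite ltnS leq_addr.
rewrite coefM (bigD1 (Ordinal lij)) //= addKn.
apply: contra (_ : ~~ mx Y (p`_i * q`_j)); last by rewrite mxMP // negb_or ni.
move=> h; rewrite -[X in mx Y X](addrK (\sum_(k < (i + j).+1 | k != Ordinal lij) p`_k * q`_(i + j - k))).
apply: mxD => //; apply: mxN; apply: mx_sum => k kij.
have : (k < i)%N || (i < k)%N by rewrite -neq_ltn; apply: contraNneq kij => kE; apply/eqP/val_inj.
case/orP => hk; first by apply: mxMr; [apply: qY|apply: ip].
by apply: mxMl; [apply: pY|apply: jq; have := ltn_ord k; lia].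
Qed.

Lemma first_unit_coef Y p : (exists i, ~~ mx Y p`_i) ->
  exists i, ~~ mx Y p`_i /\ forall k, (k < i)%N -> mx Y p`_k.
Proof.
move=> ex; exists (ex_minn ex); case: ex_minnP => i hi imin; split=> // k ki.
by apply: contraLR ki => /imin; rewrite leqNgt.
Qed.

(** The last clause makes the content c a coefficient of p, so that c stays in any subfield
    containing the coefficients. *)
Lemma primitive_part Y p : p != 0 -> exists c j, [/\ c != 0, c^-1 *: p \is a polyOver Y & c^-1 * p`_j = 1].
Proof.
move=> p0.
have [j [pj0 pj]] : exists j, p`_j != 0 /\ forall i, (i < size p)%N -> (p`_j)^-1 * p`_i \in Y.
  have : exists j, (j < size p)%N && (p`_j != 0).
    exists (size p).-1; rewrite -lead_coefE lead_coef_eq0 p0 prednK ?leqnn //.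
    by rewrite lt0n size_poly_eq0.
  elim: (size p) => [|n IHn]; first by case.
  move=> [j /andP[]]; have [/eqP pn0|pn0] := boolP (p`_n == 0).
    rewrite ltnS leq_eqVlt => /predU1P[->|jn pj0]; first by rewrite pn0 eqxx.
    have [|i [pi0 pi]] := IHn; first by exists j; rewrite jn.
    exists i; split=> // k; rewrite ltnS leq_eqVlt => /predU1P[->|]; last exact: pi.
    by rewrite pn0 mulr0 rpred0.
  have [ex _ _|nex _ _] := pselect (exists j, (j < n)%N && (p`_j != 0)); last first.
    exists n; split=> // k; rewrite ltnS leq_eqVlt => /predU1P[->|kn].
      by rewrite mulVf // rpred1.
    have -> : p`_k = 0 by apply: contrapT => /eqP pk; apply: nex; exists k; rewrite kn.
    by rewrite mulr0 rpred0.
  have [i [pi0 pi]] := IHn ex.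
  have /orP[h|h] := valringP Y (mulf_neq0 (invr_neq0 pi0) pn0).
    exists i; split=> // k; rewrite ltnS leq_eqVlt => /predU1P[->//|]; exact: pi.
  exists n; split=> // k; rewrite ltnS leq_eqVlt => /predU1P[->|kn].
    by rewrite mulVf // rpred1.
  have -> : (p`_n)^-1 * p`_k = ((p`_i)^-1 * p`_n)^-1 * ((p`_i)^-1 * p`_k).
    by rewrite invfM invrK mulrACA divff // mul1r.
  by rewrite rpredM ?pi.
exists p`_j, j; split=> //; last by rewrite mulVf.
apply/polyOverP => i; rewrite coefZ; have [/pj //|si] := ltnP i (size p).
by rewrite [p`_i]nth_default ?mulr0 ?rpred0.
Qed.

(** Contents multiply up to units, so c is the content of [p * q] divided by d, and [d^-1] lies in Y
    because q is monic. *)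
Lemma monic_factor_vring Y p q : p \is monic -> q \is monic ->
  p * q \is a polyOver Y -> p \is a polyOver Y.
Proof.
move=> pm qm pqY.
have [c [i [c0 cpY ci]]] := primitive_part Y (monic_neq0 pm).
have [d [j [d0 dqY dj]]] := primitive_part Y (monic_neq0 qm).
have dV : d^-1 \in Y.
  by have := polyOverP dqY (size q).-1; rewrite coefZ -lead_coefE (monicP qm) mulr1.
have [|i0 [ni0 i0min]] := @first_unit_coef Y (c^-1 *: p).
  by exists i; rewrite coefZ ci mx1.
have [|j0 [nj0 j0min]] := @first_unit_coef Y (d^-1 *: q).
  by exists j; rewrite coefZ dj mx1.
have nk := unit_coef_mul cpY dqY i0min ni0 j0min nj0.
move: nk (polyOverP (rpredM cpY dqY) (i0 + j0)%N).
rewrite -scalerAl -scalerAr scalerA coefZ => nk kY.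
have [k0 kV] := mx_unit nk.
have cY : c \in Y.
  have -> : c = (p * q)`_(i0 + j0) * (c^-1 / d * (p * q)`_(i0 + j0))^-1 * d^-1.
    have pq0 : (p * q)`_(i0 + j0) != 0 by apply: contraNneq k0 => ->; rewrite mulr0.
    by field; rewrite pq0 c0 d0.
  by rewrite !rpredM // (polyOverP pqY).
by rewrite -[p](scalerKV c0) polyOverZ.
Qed.

(** Modulo the maximal ideal [p * q] is a unit times a power of X, and a monic factor of that is a
    power of X. *)
Lemma monic_factor_mx Y p q : p \is monic -> p \is a polyOver Y -> q \is a polyOver Y ->
    (forall i, (i < (size (p * q)%R).-1)%N -> mx Y (p * q)`_i) -> ~~ mx Y (lead_coef (p * q)) ->
  forall i, (i < (size p).-1)%N -> mx Y p`_i.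
Proof.
move=> pm pY qY pqm; rewrite lead_coef_monicM // => qn i isp; apply: contraT => ni.
have [|i0 [ni0 i0min]] := @first_unit_coef Y p; first by exists i.
have [|j0 [nj0 j0min]] := @first_unit_coef Y q; first by exists (size q).-1.
have := unit_coef_mul pY qY i0min ni0 j0min nj0; rewrite pqm //.
have q0 : q != 0 by apply: contraNneq qn => ->; rewrite lead_coef0 mx0.
have j0q : (j0 <= (size q).-1)%N by rewrite leqNgt; apply: contraNN qn => /j0min; rewrite lead_coefE.
have i0i : (i0 <= i)%N by rewrite leqNgt; apply: contraNN ni => /i0min.
rewrite size_monicM //; have : (0 < size q)%N by rewrite lt0n size_poly_eq0.
by move: (size p) (size q) isp j0q => a b; lia.
Qed.

End ValuationPolynomials.

Section IntegralClosure.
Variable K : fieldType.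
Implicit Types (X A : K -> Prop) (D : subringClosed K) (Y : valring K).

(* The intersection of all valuation rings containing X is the integral
   closure of the ring generated by X. *)
Definition cl X y := forall Y, (forall x, X x -> x \in Y) -> y \in Y.

Fact cl_closed X : subring_closed (apred (cl X)).
Proof.
split; first by apply/asboolP => Y _; exact: rpred1.
- by move=> x y /asboolP hx /asboolP hy; apply/asboolP => Y XY; rewrite rpredB ?hx ?hy.
- by move=> x y /asboolP hx /asboolP hy; apply/asboolP => Y XY; rewrite rpredM ?hx ?hy.
Qed.
Definition clr X : {pred K} := apred (cl X).
HB.instance Definition _ X := GRing.isSubringClosed.Build K (clr X) (cl_closed X).

Lemma clP X y : reflect (cl X y) (y \in clr X). Proof. exact: asboolP. Qed.

Lemma cl_in X x : X x -> x \in clr X. Proof. by move=> Xx; apply/clP => Y; apply. Qed.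

Lemma cl_vring X Y y : y \in clr X -> (forall x, X x -> x \in Y) -> y \in Y.
Proof. by move=> /clP; apply. Qed.

Lemma cl_trans X A y : y \in clr X -> (forall x, X x -> x \in clr A) -> y \in clr A.
Proof.
move=> /clP yX XA; apply/clP => Y AY; apply: yX => x /XA /clP; exact.
Qed.

Lemma monic_root_cl X p y : p \is monic -> p \is a polyOver (clr X) -> p.[y] = 0 -> y \in clr X.
Proof.
move=> pm /polyOverP pX py; apply/clP => Y XY; apply: (monic_root_vring pm) py.
by apply/polyOverP => i; apply: (cl_vring (pX i)).
Qed.

(** If 1/y generates a proper ideal of D[1/y], a valuation ring dominating it contains D but not y.
    Otherwise 1 = P(1/y)/y, and multiplying by a power of y gives a monic equation with the
    coefficients of P in reverse order. *)
Lemma cl_ring_monic D y : cl (fun x => x \in D) y ->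
  exists p, [/\ p \is monic, p \is a polyOver D & p.[y] = 0].
Proof.
move=> clDy; have [->|y0] := eqVneq y 0.
  by exists 'X; rewrite monicX polyOverX hornerX.
have [S SE] := eval_ring D y^-1.
pose M z := exists2 P, P \is a polyOver D & z = P.[y^-1] * y^-1.
have yS : y^-1 \in S by apply/SE; exists 'X; rewrite ?polyOverX ?hornerX.
have Mid : ideal_of S M.
  split.
  - by exists 0; rewrite ?rpred0 // horner0 mul0r.
  - by move=> _ [P PD ->]; rewrite rpredM //; apply/SE; exists P.
  - by move=> _ _ [P PD ->] [Q QD ->]; exists (P + Q); rewrite ?rpredD // hornerD mulrDl.
  - by move=> _ _ /SE[Q QD <-] [P PD ->]; exists (Q * P); rewrite ?rpredM // hornerM mulrA.
have [[P PD P1]|M1] := pselect (M 1); last first.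
  have [Y [SY MY]] := dominate Mid M1.
  have : mx Y y^-1 by apply: MY; exists 1; rewrite ?rpred1 // hornerC mul1r.
  rewrite /mx invr_eq0 (negbTE y0) invrK /= => /negP[]; apply: clDy => x xD.
  by apply/SY/SE; exists x%:P; rewrite ?polyOverC ?hornerC.
pose n := size P; exists ('X^n - \poly_(i < n) P`_(n.-1 - i)); split.
- rewrite monicE lead_coefDl ?lead_coefXn ?size_polyN // size_polyXn ltnS.
  exact: size_poly.
- by rewrite rpredB ?polyOverXn // polyOver_poly // => i _; apply: (polyOverP PD).
have n0 : (0 < n)%N.
  rewrite lt0n size_poly_eq0; apply/eqP => P0; move: P1 => /eqP.
  by rewrite P0 horner0 mul0r oner_eq0.
rewrite !hornerE horner_poly; apply/eqP; rewrite subr_eq0; apply/eqP.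
rewrite -[LHS]mul1r P1 horner_coef mulr_suml mulr_suml (reindex_inj rev_ord_inj) /=.
apply: eq_bigr => i _; rewrite -/n; have -> : (n.-1 - i = n - i.+1)%N by lia.
rewrite -!mulrA; congr (_ * _); rewrite mulrA -exprSr subnSK // exprVn.
have -> : y ^+ n = y ^+ (n - i) * y ^+ i by rewrite -exprD subnK // ltnW.
by rewrite mulKf // expf_neq0.
Qed.

Lemma cl_monic X y : y \in clr X ->
  exists p, [/\ p \is monic, p \is a polyOver (genr X) & p.[y] = 0].
Proof.
move=> /clP yX; apply: cl_ring_monic => Y XY; apply: yX => x Xx.
by apply/XY/mem_gen.
Qed.

Lemma cl_clear_denominators X A b : b \in clr A ->
    (forall x, X x -> exists n, b ^+ n * x \in clr A) ->
  forall y, y \in clr X -> exists n, b ^+ n * y \in clr A.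
Proof.
move=> bA XA; have mono n m x : (n <= m)%N -> b ^+ n * x \in clr A -> b ^+ m * x \in clr A.
  by move=> nm; rewrite -(subnK nm) exprD -mulrA => ?; rewrite rpredM ?rpredX.
have genA x : x \in genr X -> exists n, b ^+ n * x \in clr A.
  move=> /asboolP; elim=> {x} [x /XA //||x y _ [n hx] _ [m hy]|x y _ [n hx] _ [m hy]].
  - by exists 0%N; rewrite mul1r rpred1.
  - by exists (maxn n m); rewrite mulrBr rpredB // (mono _ _ _ _ hx, mono _ _ _ _ hy) ?leq_maxl ?leq_maxr.
  - by exists (n + m)%N; rewrite exprD mulrACA rpredM.
move=> y /cl_monic[p [pm pX py]].
have [||N HN] := @uniform_bound (fun i n => b ^+ n * p`_i \in clr A) _ _ (size p).
- by move=> i m n mn; apply: mono.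
- by move=> i; apply/genA/(polyOverP pX).
exists N; pose n := (size p).-1.
have sp : size p = n.+1 by rewrite prednK // lt0n size_poly_eq0 monic_neq0.
have pn : p`_n = 1 by rewrite -(monicP pm) lead_coefE sp.
(* The equation of [b ^+ N * y]: the coefficient of index i gains the exponent N (n - i), which is
   at least N except at the leading 1. *)
apply: (@monic_root_cl _ (\poly_(i < n.+1) (b ^+ (N * (n - i)) * p`_i))).
- by rewrite monicE lead_coef_poly // subnn muln0 mul1r pn ?oner_neq0.
- apply/polyOverP => i; rewrite coef_poly; case: ltnP => [|_]; last exact: rpred0.
  rewrite ltnS leq_eqVlt => /predU1P[->|ilt]; first by rewrite subnn muln0 pn mulr1 rpred1.
  by apply: (mono N); [rewrite leq_pmulr // subn_gt0|apply: HN; rewrite sp ltnW].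
- rewrite horner_poly; transitivity (b ^+ (N * n) * p.[y]); last by rewrite py mulr0.
  rewrite horner_coef sp mulr_sumr; apply: eq_bigr => i _.
  rewrite exprMn -exprM mulrACA -exprD -mulnDr subnK ?mulrA //.
  by rewrite -ltnS.
Qed.

End IntegralClosure.

(** * The line over a valued field *)

Section Lines.
Variable L : fieldType.
Implicit Types (F D : subringClosed L) (Y : valring L).

(** For a subring this says subfield; no side condition is needed because [0^-1 = 0]. *)
Definition inv_closed F := forall z, z \in F -> z^-1 \in F.

Definition transcendental_over F x :=
  forall P : {poly L}, P \is a polyOver F -> P.[x] = 0 -> P = 0.

Lemma monic_cofactor_over D (P Q : {poly L}) :
  P \is monic -> P \is a polyOver D -> Q * P \is a polyOver D -> Q \is a polyOver D.
Proof.
move=> Pm PD QPD; have [Q' [S [Q'D _ e sS]]] := monic_division Pm PD QPD.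
suff -> : Q = Q' by [].
apply/eqP; rewrite -subr_eq0; apply: contraTT sS => QQ'.
have <- : (Q - Q') * P = S by rewrite mulrBl e addrC addKr.
rewrite -leqNgt size_Mmonic // -ltnS prednK ?addn_gt0 ?lt0n ?size_poly_eq0 ?QQ' //.
by rewrite -[X in (X < _)%N]add0n ltn_add2r lt0n size_poly_eq0.
Qed.

Lemma minimal_polynomial F y (H : {poly L}) : inv_closed F ->
    H \is monic -> H \is a polyOver F -> H.[y] = 0 ->
  exists mu : {poly L}, [/\ mu \is monic, mu \is a polyOver F, mu.[y] = 0 &
    forall P : {poly L}, P \is a polyOver F -> P.[y] = 0 ->
      exists2 Q, Q \is a polyOver F & P = Q * mu].
Proof.
move=> Finv Hm HF Hy.
pose good n := `[< exists P : {poly L}, [/\ P \is monic, P \is a polyOver F, P.[y] = 0 & size P = n] >].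
have ex : exists n, good n by exists (size H); apply/asboolP; exists H.
case: (ex_minnP ex) => n /asboolP[mu [mum muF muy smu]] nmin.
exists mu; split=> // P PF Py.
have [Q [S [QF SF e sS]]] := monic_division mum muF PF.
exists Q => //; suff S0 : S = 0 by rewrite e S0 addr0.
apply: contrapT => /eqP S0.
have cF : (lead_coef S)^-1 \in F by apply: Finv; apply: (polyOverP SF).
suff /nmin : good (size S) by rewrite leqNgt -smu sS.
apply/asboolP; exists ((lead_coef S)^-1 *: S); split.
- by rewrite monicE lead_coefZ mulVf // lead_coef_eq0.
- exact: polyOverZ.
- have := Py; rewrite e hornerD hornerM muy mulr0 add0r hornerZ => ->.
  by rewrite mulr0.
- by rewrite size_scale // invr_eq0 lead_coef_eq0.
Qed.

(* F[x] is a principal ideal domain, hence integrally closed. *)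
Lemma line_integrally_closed F x (a b : {poly L}) : inv_closed F -> transcendental_over F x ->
    a \is a polyOver F -> b \is a polyOver F -> b != 0 ->
    (forall Y, {subset F <= Y} -> x \in Y -> a.[x] / b.[x] \in Y) ->
  exists2 P, P \is a polyOver F & a.[x] / b.[x] = P.[x].
Proof.
move=> Finv xtr aF bF b0 cY.
(* A nonzero combination of a and b of least size, made monic, is their greatest common divisor. *)
pose good n := `[< exists u v : {poly L},
  [/\ u \is a polyOver F, v \is a polyOver F, u * a + v * b != 0 & size (u * a + v * b) = n] >].
have ex : exists n, good n.
  exists (size b); apply/asboolP; exists 0, 1.
  by rewrite rpred0 rpred1 mul0r add0r mul1r.
case: (ex_minnP ex) => n /asboolP[u0 [v0 [u0F v0F d0 sd]]] nmin.
set d' := u0 * a + v0 * b in d0 sd.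
have d'F : d' \is a polyOver F by rewrite rpredD ?rpredM.
have eF : (lead_coef d')^-1 \in F by apply: Finv; apply: (polyOverP d'F).
pose u := (lead_coef d')^-1 *: u0; pose v := (lead_coef d')^-1 *: v0.
pose d := u * a + v * b.
have dE : d = (lead_coef d')^-1 *: d' by rewrite /d /u /v -!scalerAl -scalerDr.
have uF : u \is a polyOver F by apply: polyOverZ.
have vF : v \is a polyOver F by apply: polyOverZ.
have dF : d \is a polyOver F by rewrite rpredD ?rpredM.
have dm : d \is monic by rewrite dE monicE lead_coefZ mulVf // lead_coef_eq0.
have sdn : size d = n by rewrite dE size_scale // invr_eq0 lead_coef_eq0.
have div (w : {poly L}) s t : w = s * a + t * b -> s \is a polyOver F -> t \is a polyOver F ->
    exists2 Q, Q \is a polyOver F & w = Q * d.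
  move=> wE sF tF; have wF : w \is a polyOver F by rewrite wE rpredD ?rpredM.
  have [Q [S [QF SF e sS]]] := monic_division dm dF wF.
  exists Q => //; suff S0 : S = 0 by rewrite e S0 addr0.
  apply: contrapT => /eqP S0.
  suff /nmin : good (size S) by rewrite leqNgt -sdn sS.
  have SE : S = (s - Q * u) * a + (t - Q * v) * b.
    by rewrite -[S](addKr (Q * d)) -e wE /d; ring.
  apply/asboolP; exists (s - Q * u), (t - Q * v).
  by rewrite -SE; split=> //; apply: rpredB => //; apply: rpredM.
have [|||a' a'F aE] := div a 1 0; rewrite ?rpred1 ?rpred0 ?mul1r ?mul0r ?addr0 //.
have [|||b' b'F bE] := div b 0 1; rewrite ?rpred1 ?rpred0 ?mul1r ?mul0r ?add0r //.
have dn0 := monic_neq0 dm.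
have bez : u * a' + v * b' = 1.
  by apply: (mulIf dn0); rewrite mulrDl -!mulrA -aE -bE mul1r.
have b'0 : b' != 0 by apply: contraNneq b0; rewrite bE => ->; rewrite mul0r.
have nz (P : {poly L}) : P \is a polyOver F -> P != 0 -> P.[x] != 0.
  by move=> PF; apply: contraNneq => /(xtr _ PF)/eqP.
have cE : a.[x] / b.[x] = a'.[x] / b'.[x].
  rewrite aE bE !hornerM; have := nz _ dF dn0; have := nz _ b'F b'0 => ? ?.
  by field; apply/andP.
rewrite cE; have [sb'|sb'] := leqP (size b') 1%N.
  exists ((b'`_0)^-1 *: a'); first by apply: polyOverZ => //; apply: Finv; apply: (polyOverP b'F).
  by rewrite hornerZ {1}(size1_polyC sb') hornerC mulrC.
(* If the reduced denominator b' is not constant, a valuation ring with [b'.[x]] in its maximal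
   ideal also has [a'.[x]] there, against the Bezout identity. *)
exfalso; have [S SE] := eval_ring F x.
pose M z := exists2 P, P \is a polyOver F & z = P.[x] * b'.[x].
have [||Y [SY MY]] := @dominate _ S M.
- split.
  + by exists 0; rewrite ?rpred0 // horner0 mul0r.
  + by move=> _ [P PF ->]; apply/SE; exists (P * b'); rewrite ?rpredM ?hornerM.
  + by move=> _ _ [P PF ->] [Q QF ->]; exists (P + Q); rewrite ?rpredD // hornerD mulrDl.
  + by move=> _ _ /SE[Q QF <-] [P PF ->]; exists (Q * P); rewrite ?rpredM // hornerM mulrA.
- move=> [P PF P1]; have PbF : 1 - P * b' \is a polyOver F by rewrite rpredB ?rpred1 ?rpredM.
  have /(canRL (subrK _)) : 1 - P * b' = 0.
    by apply: xtr => //; rewrite hornerD hornerN hornerM -P1 hornerC subrr.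
  rewrite add0r => e.
  have Pb0 : P * b' != 0 by rewrite -e oner_neq0.
  have P0 : P != 0 by apply: contraNneq Pb0 => ->; rewrite mul0r.
  have : (size b' <= size (P * b')%R)%N by rewrite dvdp_leq // dvdp_mull.
  by rewrite -e size_poly1 leqNgt sb'.
have FY : {subset F <= Y}.
  by move=> z zF; apply/SY/SE; exists z%:P; rewrite ?polyOverC ?hornerC.
have xY : x \in Y by apply/SY/SE; exists 'X; rewrite ?polyOverX ?hornerX.
have evY (P : {poly L}) : P \is a polyOver F -> P.[x] \in Y.
  by move=> PF; apply/SY/SE; exists P.
have mb : mx Y b'.[x] by apply: MY; exists 1; rewrite ?rpred1 // hornerC mul1r.
have ma : mx Y a'.[x].
  rewrite -(divfK (nz _ b'F b'0) a'.[x]) -cE; apply: mxMl => //; exact: cY.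
have : mx Y (u * a' + v * b').[x].
  by rewrite hornerD !hornerM; apply: mxD; apply: mxMl; rewrite ?evY.
by rewrite bez hornerC mx1.
Qed.

Section Gauss.
Variables (W : valring L) (F : subringClosed L) (x : L).
Hypotheses (Finv : inv_closed F) (xtr : transcendental_over F x).

Definition base z := z \in F /\ z \in W.
Definition base_and z := base z \/ z = x.

Let basePoly (P : {poly L}) := P \is a polyOver F /\ P \is a polyOver W.

Lemma gauss_valuation : exists Y, (forall z, base_and z -> z \in Y) /\
  forall P : {poly L}, P \is a polyOver F -> P.[x] \in Y ->
    P \is a polyOver W /\ (mx Y P.[x] -> forall i, mx W P`_i).
Proof.
have [B BE] : exists B : subringClosed L, forall z, z \in B <-> base z.
  apply: subringP; first by split; rewrite rpred1.
  - by move=> a b [? ?] [? ?]; split; rewrite rpredB.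
  - by move=> a b [? ?] [? ?]; split; rewrite rpredM.
have BP (P : {poly L}) : P \is a polyOver B <-> basePoly P.
  split=> [/polyOverP h|[/polyOverP h1 /polyOverP h2]]; last by apply/polyOverP => i; apply/BE.
  by split; apply/polyOverP => i; have /BE[] := h i.
have [S SE] := eval_ring B x.
have inj (P Q : {poly L}) : P \is a polyOver F -> Q \is a polyOver F -> P.[x] = Q.[x] -> P = Q.
  move=> PF QF e; apply/eqP; rewrite -subr_eq0; apply/eqP/xtr; first by rewrite rpredB.
  by rewrite hornerD hornerN e subrr.
pose M z := exists P : {poly L}, [/\ basePoly P, forall i, mx W P`_i & z = P.[x]].
have [|Y [SY YM]] := @dominate_prime _ S M.
  split; first split.
  - exists 0; rewrite horner0; split=> //; first by split; rewrite rpred0.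
    by move=> i; rewrite coef0 mx0.
  - by move=> _ [P [/BP PB _ ->]]; apply/SE; exists P.
  - move=> _ _ [P [[PF PW] Pm ->]] [Q [[QF QW] Qm ->]]; exists (P + Q); rewrite hornerD.
    by split=> [|i|//]; [split; rewrite rpredD|rewrite coefD mxD].
  - move=> _ _ /SE[Q /BP[QF QW] <-] [P [[PF PW] Pm ->]]; exists (Q * P); rewrite hornerM.
    split=> [|i|//]; first by split; rewrite rpredM.
    by rewrite coefM; apply: mx_sum => j _; apply: mxMl => //; apply: (polyOverP QW).
  - move=> [P [[PF PW] Pm P1]]; have P1E : P = 1.
      by apply: inj; rewrite ?rpred1 // hornerC.
    by have := Pm 0%N; rewrite P1E coef1 mx1.
  - move=> _ _ /SE[P /BP PB <-] /SE[Q /BP QB <-] [R [[RF RW] Rm e]].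
    have PQ : P * Q = R by apply: inj; rewrite ?hornerM // rpredM ?(PB.1, QB.1).
    have [[i ni]|nP] := pselect (exists i, ~~ mx W P`_i); last first.
      by left; exists P; split=> // i; apply: contrapT => /negP ni; apply: nP; exists i.
    have [[j nj]|nQ] := pselect (exists j, ~~ mx W Q`_j); last first.
      by right; exists Q; split=> // j; apply: contrapT => /negP nj; apply: nQ; exists j.
    have [|i0 [ni0 i0min]] := @first_unit_coef _ W P; first by exists i.
    have [|j0 [nj0 j0min]] := @first_unit_coef _ W Q; first by exists j.
    by have := unit_coef_mul PB.2 QB.2 i0min ni0 j0min nj0; rewrite PQ Rm.
have baseY z : base z -> z \in Y.
  by move=> bz; apply/SY/SE; exists z%:P; rewrite ?hornerC // polyOverC; apply/BE.
exists Y; split=> [z [/baseY //|->]|P PF PY].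
  by apply/SY/SE; exists 'X; rewrite ?polyOverX ?hornerX.
have PW : P \is a polyOver W.
  have [->|P0] := eqVneq P 0; first by rewrite rpred0.
  have [c [j [c0 cPW cj]]] := primitive_part W P0.
  have cE : c = P`_j by rewrite -[LHS]mulr1 -cj mulVKf.
  have cF : c \in F by rewrite cE (polyOverP PF).
  (* If the content c were outside W, its inverse would be infinitesimal and the primitive
     polynomial [c^-1 *: P] would take a value in the maximal ideal of Y. *)
  rewrite -[P](scalerKV c0) polyOverZ //; apply: contraT => cW.
  have cV : mx W c^-1 by rewrite /mx invrK cW orbT.
  have cPB : basePoly (c^-1 *: P) by split=> //; rewrite polyOverZ ?Finv.
  have cPS : (c^-1 *: P).[x] \in S by apply/SE; exists (c^-1 *: P) => //; apply/BP.
  have : M (c^-1 *: P).[x].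
    apply/YM => //; rewrite hornerZ; apply: mxMr => //.
    have VS : c^-1 \in S.
      by apply/SE; exists (c^-1)%:P; rewrite ?hornerC // polyOverC; apply/BE; split; rewrite ?Finv ?mx_in.
    apply/YM => //; exists (c^-1)%:P; rewrite hornerC; split=> //.
      by split; rewrite polyOverC ?Finv ?mx_in.
    by move=> i; rewrite coefC; case: eqP => // _; rewrite mx0.
  move=> [Q [[QF QW] Qm e]]; have QE : c^-1 *: P = Q by apply: inj; rewrite // polyOverZ ?Finv.
  by have := Qm j; rewrite -QE coefZ cj mx1.
split=> // mP i; have PS : P.[x] \in S by apply/SE; exists P => //; apply/BP.
by have /(YM _ PS)[Q [[QF QW] Qm /(inj _ _ PF QF)->]] := mP.
Qed.

End Gauss.
End Lines.

Section IntegralOverLine.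
Variables (L : fieldType) (W : valring L) (F : subringClosed L) (x : L).
Hypotheses (Finv : inv_closed F) (xtr : transcendental_over F x).

Lemma line_fractions : exists Phi : subringClosed L, inv_closed Phi /\
  forall z, z \in Phi <-> exists a b : {poly L},
    [/\ a \is a polyOver F, b \is a polyOver F, b != 0 & z = a.[x] / b.[x]].
Proof.
have nz (P : {poly L}) : P \is a polyOver F -> P != 0 -> P.[x] != 0.
  by move=> PF; apply: contraNneq => /(xtr PF)/eqP.
have [|||Phi PhiE] := @subringP L (fun z => exists a b : {poly L},
    [/\ a \is a polyOver F, b \is a polyOver F, b != 0 & z = a.[x] / b.[x]]).
- by exists 1, 1; rewrite rpred1 oner_neq0 hornerC divr1.
- move=> _ _ [a [b [aF bF b0 ->]]] [c [d [cF dF d0 ->]]].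
  exists (a * d - c * b), (b * d).
  rewrite mulf_neq0 // [_ \is a _]rpredB ?rpredM // hornerD hornerN !hornerM.
  by split=> //; have := nz _ bF b0; have := nz _ dF d0 => ? ?; field; apply/andP.
- move=> _ _ [a [b [aF bF b0 ->]]] [c [d [cF dF d0 ->]]].
  by exists (a * c), (b * d); rewrite mulf_neq0 // !rpredM // !hornerM invfM mulrACA.
exists Phi; split=> // z /PhiE[a [b [aF bF b0 ->]]]; apply/PhiE.
have [->|a0] := eqVneq a 0; first by exists 0, 1; rewrite rpred0 rpred1 oner_neq0 horner0 !mul0r invr0.
by exists b, a; rewrite invfM invrK mulrC.
Qed.

(** Polynomials in x over the intersection of F and W form a normal ring, by
    [line_integrally_closed] and the Gauss extension, so it contains the coefficients of the minimal
    polynomial of y over F(x). The last clause prepares going down: the conjugates of y are those of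
    s times T/E, which is infinitesimal for Y. *)
Lemma integral_over_line y : y \in clr (base_and W F x) ->
  exists mu : {poly L}, [/\ mu \is monic, mu.[y] = 0,
    forall i, exists P, [/\ P \is a polyOver F, P \is a polyOver W & mu`_i = P.[x]] &
    forall (Y : valring L) (E T : {poly L}) s, (forall z, base_and W F x z -> z \in Y) ->
      E \is a polyOver F -> T \is a polyOver F -> E.[x] \in Y -> ~~ mx Y E.[x] -> mx Y T.[x] ->
      s \in clr (base_and W F x) -> y * E.[x] = T.[x] * s ->
      forall i, (i < (size mu).-1)%N -> mx Y mu`_i].
Proof.
move=> ycl; have [Phi [Phinv PhiE]] := line_fractions.
have evPhi (P : {poly L}) : P \is a polyOver F -> P.[x] \in Phi.
  by move=> PF; apply/PhiE; exists P, 1; rewrite rpred1 oner_neq0 hornerC divr1.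
have genPhi : {subset genr (base_and W F x) <= Phi}.
  apply: gen_sub => w [[wF _]|->].
    by rewrite -(hornerC w x) evPhi // polyOverC.
  by rewrite -(hornerX x) evPhi ?polyOverX.
have genY (Y : valring L) : (forall z, base_and W F x z -> z \in Y) -> {subset genr (base_and W F x) <= Y}.
  exact: gen_sub.
have [H [Hm HX Hy]] := cl_monic ycl.
have [|mu [mum muPhi muy mumin]] := @minimal_polynomial _ Phi y H Phinv Hm _ Hy.
  by apply/polyOverP => i; apply/genPhi/(polyOverP HX).
have muY (Y : valring L) : (forall z, base_and W F x z -> z \in Y) -> mu \is a polyOver Y.
  move=> XY; have [|Q _ HE] := mumin H _ Hy.
    by apply/polyOverP => i; apply/genPhi/(polyOverP HX).
  have Qm : Q \is monic.
    by rewrite -(monicMr _ mum) -HE.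
  apply: (@monic_factor_vring _ _ _ Q) => //; rewrite mulrC -HE.
  by apply/polyOverP => i; apply/(genY Y XY)/(polyOverP HX).
exists mu; split=> // [i|Y E T s XY EF TF EY nE mT scl ys i isz].
- have /PhiE[a [b [aF bF b0 e]]] := polyOverP muPhi i.
  have [|P PF PE] := line_integrally_closed Finv xtr aF bF b0.
    move=> Y FY xY; rewrite -e; apply: (polyOverP (muY Y _)).
    by move=> z [[/FY]|->].
  have [Y [XY YP]] := gauss_valuation W Finv xtr.
  exists P; rewrite e PE; split=> //; have [] // := YP P PF.
  by rewrite -PE -e (polyOverP (muY Y XY)).
have [G [Gm GX Gs]] := cl_monic scl.
pose l := (size G).-1.
have sG : size G = l.+1 by rewrite prednK // lt0n size_poly_eq0 monic_neq0.
have Gl : G`_l = 1 by rewrite -(monicP Gm) lead_coefE sG.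
have E0 : E.[x] != 0 by apply: contraNneq nE => ->; rewrite mx0.
(* The equation G of s, rewritten for y through y E = T s. The lower coefficients gain a factor
   [T.[x]], while the leading one is a power of the unit [E.[x]]. *)
pose H' := \poly_(j < l.+1) (G`_j * T.[x] ^+ (l - j) * E.[x] ^+ j).
have cH' j : (j <= l)%N -> H'`_j = G`_j * T.[x] ^+ (l - j) * E.[x] ^+ j.
  by move=> jl; rewrite coef_poly ltnS jl.
have lH' : H'`_l = E.[x] ^+ l by rewrite cH' // subnn Gl !mul1r.
have sH' : size H' = l.+1.
  by rewrite size_poly_eq // subnn Gl !mul1r expf_neq0.
have H'y : H'.[y] = 0.
  rewrite horner_poly; transitivity (T.[x] ^+ l * G.[s]); last by rewrite Gs mulr0.
  rewrite (horner_coef G) sG mulr_sumr; apply: eq_bigr => j _.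
  have -> : T.[x] ^+ l = T.[x] ^+ (l - j) * T.[x] ^+ j by rewrite -exprD subnK // -ltnS.
  by rewrite -mulrA -exprMn [_ * y]mulrC ys exprMn; ring.
have H'Phi : H' \is a polyOver Phi.
  apply/polyOverP => j; rewrite coef_poly; case: ifP => _; last exact: rpred0.
  by rewrite !rpredM ?rpredX ?evPhi // genPhi // (polyOverP GX).
have TY := mx_in mT.
have H'Y : H' \is a polyOver Y.
  apply/polyOverP => j; rewrite coef_poly; case: ifP => _; last exact: rpred0.
  by rewrite !rpredM ?rpredX // (genY Y XY) // (polyOverP GX).
have [Q _ QE] := mumin _ H'Phi H'y.
have QY : Q \is a polyOver Y by apply: (monic_cofactor_over mum (muY Y XY)); rewrite -QE.
have muQ : mu * Q = H' by rewrite mulrC -QE.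
apply: (monic_factor_mx mum (muY Y XY) QY _ _ isz) => [j|]; rewrite muQ.
- rewrite sH' /= => jl; rewrite cH' ?(ltnW jl) //.
  apply: mxMr; first exact: rpredX.
  apply: mxMl; first by rewrite (genY Y XY) // (polyOverP GX).
  by rewrite mxXP // subn_gt0 jl.
- by rewrite lead_coefE sH' lH' mxXP // (negbTE nE) andbF.
Qed.

End IntegralOverLine.

(** * Residue fields *)

Section ClassicalDomain.
Variables (Q : comNzRingType) (Qdom : forall x y : Q, x * y = 0 -> (x == 0) || (y == 0)).

(** An alias of Q on which the domain structure is declared. The fraction field asks for inverses of
    units; they are chosen classically, with x itself as default value outside the units. *)
Definition idom of (forall x y : Q, x * y = 0 -> (x == 0) || (y == 0)) : Type := Q.
Local Notation I := (idom Qdom).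
HB.instance Definition _ := GRing.ComNzRing.on I.

Let unit : {pred I} := fun x => `[< exists y : I, y * x = 1 >].
Let inv (x : I) : I :=
  if pselect (exists y : I, y * x = 1) is left h then projT1 (cid h) else x.

Fact idom_mulVx : {in unit, left_inverse 1 inv *%R}.
Proof.
by move=> x /asboolP h; rewrite /inv; case: pselect => // h'; case: cid.
Qed.

Fact idom_unitPl (x y : I) : y * x = 1 -> unit x.
Proof. by move=> h; apply/asboolP; exists y. Qed.

Fact idom_invr_out : {in [predC unit], inv =1 id}.
Proof.
by move=> x /asboolP h; rewrite /inv; case: pselect.
Qed.

HB.instance Definition _ :=
  GRing.ComNzRing_hasMulInverse.Build I idom_mulVx idom_unitPl idom_invr_out.
HB.instance Definition _ := GRing.ComUnitRing_isIntegral.Build I Qdom.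

Lemma domain_field : exists (L : fieldType) (f : {rmorphism Q -> L}), forall x, f x = 0 <-> x = 0.
Proof.
exists {fraction I}, (@FracField.tofrac I : {rmorphism I -> {fraction I}}) => x.
by split=> [/eqP|->]; [rewrite tofrac_eq0 => /eqP|exact: (@tofrac0 I)].
Qed.

End ClassicalDomain.

Section ResidueField.
Variables (R : comNzRingType) (D : subringClosed R).

Record subr := Subr { subr_val : R; subr_valP : subr_val \in D }.
HB.instance Definition _ := [isSub for subr_val].
HB.instance Definition _ := [Choice of subr by <:].
HB.instance Definition _ := [SubChoice_isSubComNzRing of subr by <:].

Section Quotient.
Variables (P : R -> Prop) (Pprime : prime_of D P).

Definition subr_ideal of prime_of D P : {pred subr} := fun x => `[< P (subr_val x) >].

Fact subr_ideal_closed : idealr_closed (subr_ideal Pprime).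
Proof.
have [[P0 PD PA PM] P1 _] := Pprime; split; first exact/asboolP.
  by apply/negP => /asboolP.
move=> a x y /asboolP Px /asboolP Py; apply/asboolP; apply: PA => //.
by apply: PM => //; apply: subr_valP.
Qed.

Fact subr_ideal_prime : prime_idealr_closed (subr_ideal Pprime).
Proof.
have [_ _ Pp] := Pprime => x y /asboolP Pxy.
by have [h|h] := Pp _ _ (subr_valP x) (subr_valP y) Pxy;
  apply/orP; [left|right]; apply/asboolP.
Qed.

HB.instance Definition _ := isIdealr.Build subr (subr_ideal Pprime) subr_ideal_closed.
HB.instance Definition _ :=
  isPrimeIdealrClosed.Build subr (subr_ideal Pprime) subr_ideal_prime.

(** L is the fraction field of D/P. As D is a predicate, f is a total function with default value 0
    outside D, and its laws are stated on D. *)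
Lemma residue_field : exists (L : fieldType) (f : R -> L),
  [/\ f 1 = 1, forall x y, x \in D -> y \in D -> f (x - y) = f x - f y,
      forall x y, x \in D -> y \in D -> f (x * y) = f x * f y
    & forall x, x \in D -> f x = 0 <-> P x].
Proof.
pose Q : comNzRingType := {ideal_quot subr_ideal Pprime}.
have [L [g g0]] := domain_field (@Quotient.rquot_IdomainAxiom _ (subr_ideal Pprime)).
pose h : {rmorphism subr -> L} := g \o \pi_Q%qT.
pose f x := if insub x is Some t then h t else 0.
have fE x (xD : x \in D) : f x = h (Subr xD) by rewrite /f insubT.
exists L, f; split.
- by rewrite (fE _ (rpred1 _)) -(rmorph1 h); congr (h _); apply/val_inj.
- move=> x y xD yD; rewrite (fE _ xD) (fE _ yD) (fE _ (rpredB xD yD)) -rmorphB.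
  by congr (h _); apply/val_inj.
- move=> x y xD yD; rewrite (fE _ xD) (fE _ yD) (fE _ (rpredM xD yD)) -rmorphM.
  by congr (h _); apply/val_inj.
- move=> x xD; rewrite (fE _ xD) /h /= g0.
  have e := Quotient.idealrBE (subr_ideal Pprime) (Subr xD) 0.
  have memE : (Subr xD \in subr_ideal Pprime) = `[< P x >] by [].
  rewrite subr0 memE in e; split.
    move=> h0; apply/asboolP; rewrite e; apply/eqP.
    by rewrite h0 -(rmorph0 (\pi_Q : {rmorphism subr -> Q})%qT).
  move=> /asboolP Px; move: e; rewrite Px => /esym/eqP ->.
  exact: (rmorph0 (\pi_Q : {rmorphism subr -> Q})%qT).
Qed.

End Quotient.
End ResidueField.

(** * Zariski's main theorem *)

Lemma monic_root_mx (L : fieldType) (W : valring L) (mu : {poly L}) y : mu \is monic ->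
  mu.[y] = 0 -> y \in W -> (forall i, (i < (size mu).-1)%N -> mx W mu`_i) -> mx W y.
Proof.
move=> mum muy yW mum_mx; pose n := (size mu).-1.
have sm : size mu = n.+1 by rewrite prednK // lt0n size_poly_eq0 monic_neq0.
have mun : mu`_n = 1 by rewrite -(monicP mum) lead_coefE sm.
have : mx W (y ^+ n); last by rewrite mxXP // => /andP[].
move: muy; rewrite horner_coef sm big_ord_recr /= mun mul1r addrC.
move=> /(canRL (addrK _)) ->; rewrite sub0r; apply: mxN; apply: mx_sum => i _.
by apply: mxMr; [rewrite rpredX|apply: mum_mx].
Qed.

Lemma reverse_horner (L : fieldType) (Y : valring L) (P : {poly L}) x m :
    P \is a polyOver Y -> (size P <= m.+1)%N -> x != 0 -> mx Y x^-1 ->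
  mx Y (x^-1 ^+ m * P.[x] - P`_m).
Proof.
move=> PY sP x0 xV; rewrite (horner_coef_wide _ sP) big_ord_recr /= mulrDr mulrCA.
rewrite -exprMn mulVf // expr1n mulr1 addrK mulr_sumr; apply: mx_sum => i _.
rewrite mulrCA; apply: mxMl; first exact: (polyOverP PY).
have -> : x^-1 ^+ m = x^-1 ^+ (m - i) * x^-1 ^+ i by rewrite -exprD subnK // ltnW.
by rewrite -mulrA -exprMn mulVf // expr1n mulr1 mxXP ?mx_in // subn_gt0 ltn_ord.
Qed.

Definition int_closed (K : fieldType) (O : subringClosed K) :=
  forall y, cl (fun z => z \in O) y -> y \in O.

Definition adj (K : fieldType) (O : subringClosed K) x z := z \in O \/ z = x.

Lemma adj_vring (K : fieldType) (O : subringClosed K) (Y : valring K) x :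
  (forall z, adj O x z -> z \in Y) <-> {subset O <= Y} /\ x \in Y.
Proof.
split=> [h|[h xY] z [/h //|->//]].
by split=> [z zO|]; apply: h; [left|right].
Qed.

Section Center.
Variables (K : fieldType) (V : valring K) (O : subringClosed K) (x : K).
Hypotheses (Ocl : int_closed O) (xV : x \in V).
Hypothesis xO : forall b, b \in O -> ~~ mx V b -> b * x \notin O.

(** The leading coefficient times x is integral over O, hence in O. No multiplier outside the
    maximal ideal brings x into O, so the leading coefficient is infinitesimal; absorbing its
    product with x into the next coefficient lowers the degree. *)
Lemma relation_coefs (F : {poly K}) : F \is a polyOver O -> F.[x] = 0 -> forall i, mx V F`_i.
Proof.
move: {2}(size F) (leqnn (size F)) => n; elim: n F => [|n IHn] F sF FO Fx i.
  by rewrite nth_default ?mx0 // (leq_trans sF).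
case: n sF IHn => [|n] sF IHn.
  move: Fx; rewrite (size1_polyC sF) hornerC => -> /=.
  by rewrite coefC; case: ifP; rewrite mx0.
have aO : F`_n.+1 \in O by apply: (polyOverP FO).
pose y := F`_n.+1 * x.
have yO : y \in O.
  (* Where x is not in Y, dividing the relation by [x ^+ n] expresses y through powers of [x^-1]. *)
  apply: Ocl => Y OY; have [xY|xY] := boolP (x \in Y); first by apply: rpredM => //; apply: OY.
  have x0 : x != 0 by apply: contraNneq xY => ->; rewrite rpred0.
  have xVY : x^-1 \in Y by have := valringP Y x0; rewrite (negbTE xY).
  have e : \sum_(j < n.+1) F`_j * x^-1 ^+ (n - j) + y = 0.
    transitivity (x^-1 ^+ n * F.[x]); last by rewrite Fx mulr0.
    rewrite (horner_coef_wide _ sF) [in RHS]big_ord_recr /= mulrDr mulr_sumr; congr (_ + _).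
      apply: eq_bigr => j _.
      have -> : x^-1 ^+ n = x^-1 ^+ (n - j) * x^-1 ^+ j by rewrite -exprD subnK // -ltnS.
      rewrite mulrCA -mulrA -exprMn mulVf // expr1n mulr1 //.
    have -> : x^-1 ^+ n * (F`_n.+1 * x ^+ n.+1) = F`_n.+1 * ((x^-1 * x) ^+ n * x).
      by rewrite exprMn exprSr; ring.
    by rewrite mulVf // expr1n mul1r.
  have -> : y = - \sum_(j < n.+1) F`_j * x^-1 ^+ (n - j).
    by apply/eqP; rewrite -addr_eq0 addrC e.
  rewrite rpredN rpred_sum // => j _; apply: rpredM; last exact: rpredX.
  by apply: OY; apply: (polyOverP FO).
have ma : mx V F`_n.+1.
  by apply: contraT => /(xO aO); rewrite yO.
have my : mx V y by apply: mxMr.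
have mF' : forall j, mx V (F - F`_n.+1 *: 'X^(n.+1) + y *: 'X^n)`_j.
  apply: IHn.
  - apply/leq_sizeP => j nj; rewrite coefD coefB !coefZ !coefXn.
    rewrite (gtn_eqF nj) mulr0 addr0; have [->|jn] := eqVneq j n.+1; first by rewrite mulr1 subrr.
    rewrite mulr0 subr0 nth_default //; apply: leq_trans sF _.
    by rewrite ltn_neqAle eq_sym jn nj.
  - by rewrite rpredD ?rpredB // polyOverZ ?polyOverXn.
  - by rewrite !hornerE Fx /y; rewrite exprSr; ring.
have [->//|ni] := eqVneq i n.+1; have := mF' i; rewrite coefD coefB !coefZ !coefXn.
rewrite (negbTE ni) mulr0 subr0; case: eqP => _; rewrite ?mulr0 ?addr0 // mulr1 => h.
by rewrite -(addrK y F`_i); apply: mxD => //; apply: mxN.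
Qed.

Lemma residual_coefs (F G : {poly K}) : F \is a polyOver O -> G \is a polyOver O ->
  F.[x] = G.[x] -> (forall i, mx V G`_i) -> forall i, mx V F`_i.
Proof.
move=> FO GO e Gm i; rewrite -(subrK G`_i F`_i); apply: mxD => //.
rewrite -coefB; apply: relation_coefs; first by rewrite rpredB.
by rewrite hornerD hornerN e subrr.
Qed.

End Center.

(* Division by F leaves a remainder t' with t' F(x) of smaller degree in x; a
   valuation ring containing O and 1/a but not x then makes t' infinitesimal. *)
Lemma conductor_lead (K : fieldType) (O : subringClosed K) x t (F R : {poly K}) :
    int_closed O -> cl (adj O x) t -> F \is a polyOver O -> R \is a polyOver O ->
    t * F.[x] = R.[x] ->
  exists n, exists2 T, T \is a polyOver O & lead_coef F ^+ n * t = T.[x].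
Proof.
move=> Ocl tcl FO RO tF; set a := lead_coef F.
have aO : a \in O by apply: (polyOverP FO).
have [a0|a0] := eqVneq a 0.
  by exists 1%N, 0; rewrite ?rpred0 // a0 expr1 mul0r horner0.
pose D : subringClosed K := GRing.SubringClosed.clone K (clr (adj O a^-1)) _.
have aD : a^-1 \in D by apply: cl_in; right.
have OD : {subset O <= D} by move=> z zO; apply: cl_in; left.
have ODp : {subset polyOver O <= polyOver D} by apply: polyOverS.
have DY (Y : valring K) : {subset O <= Y} -> a^-1 \in Y -> {subset D <= Y}.
  by move=> OY aY z /cl_vring; apply; apply/adj_vring.
pose F' := a^-1 *: F.
have F'm : F' \is monic by rewrite monicE lead_coefZ mulVf.
have F'D : F' \is a polyOver D by rewrite polyOverZ ?ODp.
have [|Q [S [QD SD e sS]]] := @monic_division _ D F' (a^-1 *: R) F'm F'D.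
  by rewrite polyOverZ ?ODp.
pose t' := t - Q.[x].
have t'F : t' * F'.[x] = S.[x].
  have := congr1 (fun P => P.[x]) e; rewrite hornerD hornerM !hornerZ -tF => e'.
  by rewrite /t' mulrBl mulrCA e' addrC addKr.
have t'D : t' \in D.
  apply/clP => Y /adj_vring[OY aY].
  have QY : Q \is a polyOver Y by apply: polyOverS QD; apply: DY.
  have SY : S \is a polyOver Y by apply: polyOverS SD; apply: DY.
  have F'Y : F' \is a polyOver Y by apply: polyOverS F'D; apply: DY.
  have [xY|xY] := boolP (x \in Y).
    by rewrite rpredB ?horner_over //; apply: tcl; apply/adj_vring.
  have x0 : x != 0 by apply: contraNneq xY => ->; rewrite rpred0.
  have xV : mx Y x^-1 by rewrite /mx invrK xY orbT.
  have F'0 := monic_neq0 F'm.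
  pose m := (size F').-1.
  have sF' : size F' = m.+1 by rewrite prednK // size_poly_gt0.
  have hF' : mx Y (x^-1 ^+ m * F'.[x] - 1).
    have <- : F'`_m = 1 by rewrite -(monicP F'm) lead_coefE sF'.
    by apply: reverse_horner => //; rewrite sF'.
  have hS : mx Y (x^-1 ^+ m * S.[x]).
    have -> : x^-1 ^+ m * S.[x] = x^-1 ^+ m * S.[x] - S`_m.
      by rewrite [S`_m]nth_default ?subr0 // -ltnS -sF'.
    by apply: reverse_horner => //; rewrite -sF' ltnW.
  set u := x^-1 ^+ m * F'.[x] in hF'.
  have uY : u \in Y by rewrite -(subrK 1 u) rpredD ?rpred1 ?mx_in.
  have un : ~~ mx Y u.
    apply/negP => mu; suff : mx Y 1 by rewrite mx1.
    by rewrite -(subKr u 1); apply: mxD mu _; apply: mxN.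
  have [u0 uV] := mx_unit un.
  have -> : t' = x^-1 ^+ m * S.[x] * u^-1.
    by rewrite -t'F mulrCA -/u mulfK.
  by apply: rpredM => //; apply: mx_in.
have aclO : a \in clr (fun z => z \in O) by exact: cl_in.
have clearD y : y \in D -> exists n, a ^+ n * y \in O.
  move=> yD; have [|n /clP hn] := cl_clear_denominators aclO _ yD; last by exists n; apply: Ocl.
  move=> z [zO|->]; first by exists 0%N; rewrite mul1r cl_in.
  by exists 1%N; rewrite expr1 mulfV // rpred1.
have mono y m n : (m <= n)%N -> a ^+ m * y \in O -> a ^+ n * y \in O.
  by move=> mn; rewrite -(subnK mn) exprD -mulrA => ?; rewrite rpredM ?rpredX.
have [n0 hn0] := clearD _ t'D.
have [||n1 hn1] := @uniform_bound (fun i n => a ^+ n * Q`_i \in O) _ _ (size Q).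
- by move=> i m n; apply: mono.
- by move=> i; apply: clearD; apply: (polyOverP QD).
pose n := maxn n0 n1; exists n.
exists ((a ^+ n * t')%:P + a ^+ n *: Q); last by rewrite !hornerE -mulrDr subrK.
apply: rpredD; first by rewrite polyOverC; apply: (mono _ n0 n) => //; apply: leq_maxl.
apply/polyOverP => i; rewrite coefZ; have [lt|ge] := ltnP i (size Q).
  by apply: (mono _ n1 n); [apply: leq_maxr|apply: hn1].
by rewrite nth_default // mulr0 rpred0.
Qed.

Section HomOnSubring.
Variables (K L : fieldType) (D : subringClosed K) (f : K -> L).
Hypotheses (f1 : f 1 = 1) (fB : forall x y, x \in D -> y \in D -> f (x - y) = f x - f y).
Hypothesis fM : forall x y, x \in D -> y \in D -> f (x * y) = f x * f y.

Lemma hom0 : f 0 = 0.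
Proof. by rewrite -(subrr 1) fB ?rpred1 // subrr. Qed.

Lemma homD x y : x \in D -> y \in D -> f (x + y) = f x + f y.
Proof.
move=> xD yD; rewrite -{1}[y]opprK fB ?rpredN // -[- y]sub0r fB ?rpred0 //.
by rewrite hom0 sub0r opprK.
Qed.

Lemma homX x n : x \in D -> f (x ^+ n) = f x ^+ n.
Proof.
by move=> xD; elim: n => [|n IHn]; rewrite ?expr0 // !exprS fM ?rpredX // IHn.
Qed.

(** The coefficientwise image under a map that respects the operations on D only. *)
Definition hom_poly (p : {poly K}) := \poly_(i < size p) f p`_i.

Lemma coef_hom_poly p i : (hom_poly p)`_i = f p`_i.
Proof.
rewrite coef_poly; case: ltnP => // sp; by rewrite nth_default // hom0.
Qed.

Lemma hom_horner (p : {poly K}) x : p \is a polyOver D -> x \in D -> f p.[x] = (hom_poly p).[f x].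
Proof.
move=> pD xD; rewrite horner_poly horner_coef.
elim: (size p) => [|n IHn]; first by rewrite !big_ord0 hom0.
have pi i : p`_i \in D by apply: (polyOverP pD).
rewrite !big_ord_recr /= homD ?IHn ?fM ?homX ?rpredM ?rpredX //.
by apply: rpred_sum => i _; rewrite rpredM ?rpredX.
Qed.

Lemma hom_poly_monic (p : {poly K}) : p \is monic -> hom_poly p \is monic.
Proof.
move=> pm; rewrite monicE lead_coef_poly -?lead_coefE ?(monicP pm) ?f1 ?oner_neq0 //.
by rewrite size_poly_gt0 monic_neq0.
Qed.

End HomOnSubring.

Section GoingDown.
Variables (K : fieldType) (V : valring K) (O S : subringClosed K) (x : K) (P : K -> Prop).
Hypotheses (OS : {subset O <= S}) (xS : x \in S) (SV : {subset S <= V}).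
Hypotheses (Pprime : prime_of S P) (PV : forall z, P z -> mx V z).
Hypothesis xtr : forall F : {poly K}, F \is a polyOver O -> P F.[x] -> forall i, P F`_i.

(** Modulo P, x becomes transcendental over the fraction field of the image of O, so g becomes
    integral over a normal polynomial ring and has a minimal polynomial with coefficients there. For
    the Gauss extension [H.[x]] is a unit and b is infinitesimal, which makes the lower coefficients
    infinitesimal. *)
Lemma going_down b (H : {poly K}) g s :
    b \in O -> mx V b -> H \is a polyOver O -> (exists i, ~~ mx V H`_i) ->
    g \in S -> s \in S -> cl (adj O x) g -> cl (adj O x) s -> g * H.[x] = b * s ->
  mx V g.
Proof.
move=> bO mb HO [i0 ni0] gS sS gcl scl e.
have [L [f [f1 fB fM fP]]] := residue_field Pprime.
have f0 := hom0 fB.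
have OSp : {subset polyOver O <= polyOver S} by apply: polyOverS.
have fH (p : {poly K}) : p \is a polyOver S -> f p.[x] = (hom_poly f p).[f x].
  by move=> pS; apply: (hom_horner f1 fB fM).
have [T TE] : exists T : subringClosed L, forall z, z \in T <-> exists2 a, a \in S & f a = z.
  apply: subringP; first by exists 1; rewrite ?rpred1.
  - by move=> _ _ [a aS <-] [c cS <-]; exists (a - c); rewrite ?rpredB ?fB.
  - by move=> _ _ [a aS <-] [c cS <-]; exists (a * c); rewrite ?rpredM ?fM.
have fmx a c : a \in S -> c \in S -> f a = f c -> mx V a -> mx V c.
  move=> aS cS ac ma; rewrite -(subKr a c); apply: mxD => //; apply: mxN; apply: PV.
  by apply/fP; rewrite ?rpredB // fB // ac subrr.
(* Since P lies in [mx V], the image of the centre of V in S/P is again a prime; W is centred there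
   and plays the role of V on L. *)
have [|W [TW WN]] := @dominate_prime _ T (fun z => exists a, [/\ a \in S, mx V a & f a = z]).
  split; first split.
  - by exists 0; rewrite rpred0 mx0.
  - by move=> _ [a [aS _ <-]]; apply/TE; exists a.
  - move=> _ _ [a [aS ma <-]] [c [cS mc <-]]; exists (a + c).
    by rewrite rpredD // mxD // (homD fB).
  - move=> _ _ /TE[a aS <-] [c [cS mc <-]]; exists (a * c).
    by rewrite rpredM // mxMl ?SV // fM.
  - by move=> [a [aS ma fa]]; have := fmx _ 1 aS (rpred1 _); rewrite fa f1 mx1 => /(_ erefl ma).
  - move=> _ _ /TE[a aS <-] /TE[c cS <-] [d [dS md fd]].
    have : mx V (a * c) by apply: (fmx d); rewrite ?rpredM // fM.
    by rewrite mxMP ?SV // => /orP[h|h]; [left; exists a|right; exists c].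
have WS a : a \in S -> mx W (f a) = mx V a.
  move=> aS; have faT : f a \in T by apply/TE; exists a.
  apply/idP/idP => [/(WN _ faT)[c [cS mc ca]]|ma]; first exact: fmx ca mc.
  by apply/(WN _ faT); exists a.
have fW a : a \in S -> f a \in W by move=> aS; apply/TW/TE; exists a.
have [|||F FE] := @subringP L (fun z => exists a c, [/\ a \in O, c \in O, f c != 0 & z = f a / f c]).
- by exists 1, 1; rewrite rpred1 f1 oner_neq0 divr1.
- move=> _ _ [a [c [aO cO c0 ->]]] [a' [c' [a'O c'O c'0 ->]]].
  exists (a * c' - a' * c), (c * c').
  rewrite !fM ?OS // fB ?rpredM ?OS // !fM ?OS // mulf_neq0 // ?rpredB ?rpredM //.
  by split=> //; field; apply/andP.
- move=> _ _ [a [c [aO cO c0 ->]]] [a' [c' [a'O c'O c'0 ->]]].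
  by exists (a * a'), (c * c'); rewrite !fM ?OS // mulf_neq0 // !rpredM // invfM mulrACA.
have Finv : inv_closed F.
  move=> z /FE[a [c [aO cO c0 ->]]]; apply/FE.
  have [->|a0] := eqVneq (f a) 0; last by exists c, a; rewrite invfM invrK mulrC.
  by exists 0, 1; rewrite rpred0 rpred1 f0 f1 oner_neq0 !mul0r invr0.
have fF a : a \in O -> f a \in F.
  by move=> aO; apply/FE; exists a, 1; rewrite rpred1 f1 oner_neq0 divr1.
have Ftr : transcendental_over F (f x).
  move=> Q QF Qx.
  have [c [cO c0 cQ]] : exists c, [/\ c \in O, f c != 0 &
      forall i, (i < size Q)%N -> exists2 a, a \in O & f c * Q`_i = f a].
    elim: (size Q) => [|n [c [cO c0 cQ]]]; first by exists 1; rewrite rpred1 f1 oner_neq0.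
    have /FE[a [d [aO dO d0 ad]]] := polyOverP QF n.
    exists (c * d); rewrite rpredM // fM ?OS // mulf_neq0 //; split=> // i.
    rewrite ltnS leq_eqVlt => /predU1P[->|/cQ[a' a'O e']].
      exists (c * a); first exact: rpredM.
      by rewrite ad fM ?OS // -mulrA; congr (_ * _); rewrite mulrCA divff ?mulr1.
    by exists (d * a'); rewrite ?rpredM // fM ?OS // -e' mulrCA mulrA.
  have [G GO GQ] : exists2 G, G \is a polyOver O & hom_poly f G = f c *: Q.
    have /choice[h hE] : forall i, exists a, a \in O /\ f c * Q`_i = f a.
      move=> i; have [/cQ[a aO ea]|si] := ltnP i (size Q); first by exists a.
      by exists 0; rewrite rpred0 nth_default // mulr0 f0.
    exists (\poly_(i < size Q) h i).
      by apply: polyOver_poly => i _; case: (hE i).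
    apply/polyP => i; rewrite (coef_hom_poly fB) coefZ coef_poly.
    case: ltnP => si; first by case: (hE i).
    by rewrite f0 nth_default // mulr0.
  have GS := OSp _ GO.
  have PG : P G.[x].
    by apply/fP; rewrite ?horner_over // fH // GQ hornerZ Qx mulr0.
  apply/polyP => i; rewrite coef0; apply: (mulfI c0); rewrite mulr0 -coefZ -GQ.
  by rewrite (coef_hom_poly fB); apply/fP; [apply: (polyOverP GS)|apply: xtr].
have baseO a : a \in O -> base W F (f a) by move=> aO; split; [apply: fF|apply: fW; apply: OS].
have clf y : y \in S -> cl (adj O x) y -> f y \in clr (base_and W F (f x)).
  move=> yS /clP/cl_monic[p [pm pX py]].
  have genS z : z \in genr (adj O x) -> z \in S /\ f z \in clr (base_and W F (f x)).
    move=> /asboolP; elim=> {z} [z [zO|->]||a c _ [aS fa] _ [cS fc]|a c _ [aS fa] _ [cS fc]].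
    - by split; [apply: OS|apply: cl_in; left; apply: baseO].
    - by split=> //; apply: cl_in; right.
    - by rewrite f1 !rpred1.
    - by rewrite fB // !rpredB.
    - by rewrite fM // !rpredM.
  apply: (@monic_root_cl _ _ (hom_poly f p)); first exact: (hom_poly_monic f1).
    by apply/polyOverP => i; rewrite (coef_hom_poly fB); apply: (genS _ _).2; apply: (polyOverP pX).
  rewrite -(hom_horner f1 fB fM) ?py //.
  by apply/polyOverP => i; apply: (genS _ _).1; apply: (polyOverP pX).
have [mu [mum mux muP muY]] := integral_over_line Finv Ftr (clf _ gS gcl).
have [Y [XY YP]] := gauss_valuation W Finv Ftr.
pose E := hom_poly f H.
have HS := OSp _ HO.
have EF : E \is a polyOver F.
  by apply/polyOverP => i; rewrite (coef_hom_poly fB) fF // (polyOverP HO).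
have evY (Q : {poly L}) : Q \is a polyOver F -> Q \is a polyOver W -> Q.[f x] \in Y.
  move=> /polyOverP QF /polyOverP QW; apply: horner_over; last by apply: XY; right.
  by apply/polyOverP => i; apply: XY; left.
have EY : E.[f x] \in Y.
  apply: evY => //; apply/polyOverP => i; rewrite (coef_hom_poly fB) fW //.
  exact: (polyOverP HS).
have nE : ~~ mx Y E.[f x].
  apply/negP => /((YP _ EF EY).2)/(_ i0).
  by rewrite (coef_hom_poly fB) WS ?(negbTE ni0) // (polyOverP HS).
have mT : mx Y (f b)%:P.[f x].
  rewrite hornerC /mx; have [//|fb0 /=] := eqVneq (f b) 0; apply/negP => fbY.
  have [||+ _] := YP (f b)^-1%:P; rewrite ?polyOverC ?hornerC ?Finv ?fF //.
  by apply/negP; have := WS _ (OS bO); rewrite mb /mx (negbTE fb0).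
have fe : f g * E.[f x] = (f b)%:P.[f x] * f s.
  have -> : f g * E.[f x] = f (g * H.[x]) by rewrite fM ?horner_over // fH.
  by rewrite e hornerC; apply: fM => //; apply: OS.
have bF : (f b)%:P \is a polyOver F by rewrite polyOverC fF.
rewrite -WS //; apply: (monic_root_mx mum mux); first exact: fW.
move=> i /(muY Y E (f b)%:P (f s) XY EF bF EY nE mT (clf _ sS scl) fe) mi.
have [Q [QF QW Qi]] := muP i; rewrite Qi in mi *.
(* Smallness of [Q.[f x]] for the Gauss extension is smallness of all its coefficients in W, hence
   smallness of [Q.[f x]] in W itself. *)
have Qm := (YP Q QF (mx_in mi)).2 mi.
rewrite horner_coef; apply: mx_sum => j _; apply: mxMr => //.
by apply: rpredX; apply: fW.
Qed.

End GoingDown.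

Section QuasiFinite.
Variables (K : fieldType) (V : valring K) (O : subringClosed K) (x : K).
Hypotheses (Ocl : int_closed O) (OV : {subset O <= V}) (xV : x \in V).
Hypothesis xO : forall b, b \in O -> ~~ mx V b -> b * x \notin O.

(* Peskine's argument: if the conductor J of O[x, g, s] into O[x] is not
   centered in V one descends to O[x]; otherwise x is transcendental modulo a
   minimal prime of J, and going down applies. *)
Lemma fiber_not_isolated b (H : {poly K}) g s :
    b \in O -> mx V b -> H \is a polyOver O -> (exists i, ~~ mx V H`_i) ->
    cl (adj O x) g -> cl (adj O x) s -> g * H.[x] = b * s ->
  mx V g.
Proof.
move=> bO mb HO Hu gcl scl e.
have XV z : adj O x z -> z \in V by apply: (adj_vring O V x).2.
have gV : g \in V by apply: gcl.
have sV : s \in V by apply: scl.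
have [B BE] := eval_ring O x.
have XB z : adj O x z -> z \in B.
  move=> [zO|->]; apply/BE; first by exists z%:P; rewrite ?polyOverC ?hornerC.
  by exists 'X; rewrite ?polyOverX ?hornerX.
have BX z : z \in B -> cl (adj O x) z.
  move=> /BE[F FO <-] Y /adj_vring[OY xY]; apply: horner_over => //.
  by apply: polyOverS FO.
pose S : subringClosed K := GRing.SubringClosed.clone K (genr (fun z => adj O x z \/ (z = g \/ z = s))) _.
have Sin z : adj O x z \/ (z = g \/ z = s) -> z \in S by move=> ?; apply: mem_gen.
have OS : {subset O <= S} by move=> z zO; apply: Sin; left; left.
have xS : x \in S by apply: Sin; left; right.
have gS : g \in S by apply: Sin; right; left.
have sS : s \in S by apply: Sin; right; right.
have Scl z : z \in S -> cl (adj O x) z.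
  move=> zS; apply/clP; move: z zS; apply: gen_sub => z [/cl_in //|[->|->]]; exact/clP.
have SV : {subset S <= V} by move=> z /Scl; apply.
(* The conductor is tested on the monomials in g and s, which span S over B. *)
pose J j := j \in S /\ forall i k, j * (g ^+ i * s ^+ k) \in B.
have Jid : ideal_of S J.
  split.
  - by split=> [|i k]; rewrite ?mul0r rpred0.
  - by move=> j [].
  - by move=> j j' [jS jB] [j'S j'B]; split=> [|i k]; rewrite ?mulrDl rpredD.
  move=> a j /asboolP aS; elim: aS j => {a} [a aX||a c|a c].
  - move=> j [jS jB]; split=> [|i k]; first by rewrite rpredM // Sin.
    case: aX => [/XB aB|[->|->]]; first by rewrite -mulrA rpredM.
      by have -> : g * j * (g ^+ i * s ^+ k) = j * (g ^+ i.+1 * s ^+ k) by rewrite exprS; ring.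
    by have -> : s * j * (g ^+ i * s ^+ k) = j * (g ^+ i * s ^+ k.+1) by rewrite exprS; ring.
  - by move=> j; rewrite mul1r.
  - move=> _ aJ _ cJ j jJ; have [ajS ajB] := aJ _ jJ; have [cjS cjB] := cJ _ jJ.
    by split=> [|i k]; rewrite mulrBl ?mulrBl rpredB.
  - by move=> _ aJ _ cJ j jJ; rewrite -mulrA; apply/aJ/cJ.
(* If j in J lies outside [mx V], then j g = G(x) and j s = T(x) with G and T over O. The equation
   becomes (G H)(x) = (b T)(x), so all coefficients of G H are infinitesimal, and those of G too
   because H has a unit coefficient. *)
have [[j [[jS jB] nj]]|Jm] := pselect (exists j, J j /\ ~~ mx V j).
  have /BE[G GO Gx] : j * g \in B by have := jB 1%N 0%N; rewrite expr1 expr0 mulr1.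
  have /BE[T TO Tx] : j * s \in B by have := jB 0%N 1%N; rewrite expr1 expr0 mul1r.
  have GHm : forall i, mx V (G * H)`_i.
    apply: (@residual_coefs _ V O x Ocl xV xO _ (b *: T)).
    - by rewrite rpredM.
    - exact: polyOverZ.
    - by rewrite hornerM hornerZ Gx Tx -mulrA e mulrCA.
    - by move=> i; rewrite coefZ; apply: mxMr => //; apply: OV; apply: (polyOverP TO).
  have Gm i : mx V G`_i.
    apply: contraT => ni.
    have [|i0 [ni0 i0min]] := @first_unit_coef _ V G; first by exists i.
    have [j0 [nj0 j0min]] := first_unit_coef Hu.
    have := unit_coef_mul (polyOverS OV GO) (polyOverS OV HO) i0min ni0 j0min nj0.
    by rewrite GHm.
  have : mx V (j * g).
    rewrite -Gx horner_coef; apply: mx_sum => i _; apply: mxMr => //; exact: rpredX.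
  by rewrite mxMP ?SV // (negbTE nj).
have [||||P [Pprime JP PM Pmin]] := @prime_avoid _ S J (fun z => z \in S /\ ~~ mx V z) Jid.
- by rewrite rpred1 mx1.
- by move=> z [].
- by move=> y z [yS ny] [zS nz]; rewrite rpredM // mxMP ?SV // negb_or ny.
- by move=> z [zS nz] Jz; apply: Jm; exists z.
have PV z : P z -> mx V z.
  move=> Pz; apply: contraT => nz; have [[_ PS _ _] _ _] := Pprime.
  by case: (PM z) => //; split=> //; apply: PS.
apply: (@going_down K V O S x P OS xS SV Pprime PV _ b H g s) => //.
have red t : cl (adj O x) t -> exists r, forall n, exists2 R : {poly K}, R \is a polyOver B &
    (size R <= r)%N /\ t ^+ n = R.[t].
  move=> /clP/cl_monic[p [pm pX pt]]; exists (size p) => n.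
  have pB : p \is a polyOver B by apply: polyOverS pX; apply: gen_sub.
  have [Q [R [_ RB eX sR]]] := monic_division pm pB (rpredX n (polyOverX B)).
  exists R => //; split; first exact: ltnW.
  by rewrite -hornerXn eX hornerD hornerM pt mulr0 add0r.
have [rg redg] := red g gcl; have [rs reds] := red s scl.
have PA a c : a \in S -> c \in S -> P (a * c) -> P a \/ P c by case: Pprime => _ _; apply.
move=> F; move: {2}(size F) (leqnn (size F)) => n; elim: n F => [|n IHn] F sF FO PF i.
  rewrite nth_default ?(leq_trans sF) //; by case: Pprime => -[].
have FS : F \is a polyOver S by apply: polyOverS FO.
pose a := lead_coef F.
have aO : a \in O by apply: (polyOverP FO).
have Pa : P a.
  (* Minimality of P over J gives u outside P with u F(x)^l in J. By [conductor_lead], F(x) can be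
     traded for its leading coefficient a: some a^M u lies in J, hence a lies in P. *)
  have [u [l [uS nPu [uFS uFB]]]] := Pmin _ PF.
  have lift t : cl (adj O x) t -> t * F.[x] ^+ l \in B -> exists m, a ^+ m * t \in B.
    move=> tcl /BE[R RO Rx].
    have [|||m [T TO Tx]] := @conductor_lead K O x t (F ^+ l) R Ocl tcl.
    - by rewrite rpredX.
    - by [].
    - by rewrite horner_exp Rx.
    by exists (l * m)%N; rewrite exprM -lead_coef_exp Tx; apply/BE; exists T.
  have aB : a \in B by apply: XB; left.
  have mono t m m' : (m <= m')%N -> a ^+ m * t \in B -> a ^+ m' * t \in B.
    by move=> mm; rewrite -(subnK mm) exprD -mulrA => ?; apply: rpredM => //; apply: rpredX.
  have lift2 i1 k1 : exists m, a ^+ m * (u * (g ^+ i1 * s ^+ k1)) \in B.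
    apply: lift.
      by move=> Y XY; rewrite !rpredM ?rpredX ?(Scl u uS) ?gcl ?scl.
    by have := uFB i1 k1; rewrite mulrAC.
  (* A single exponent has to serve all monomials in g and s; those with exponents below rg and rs
     suffice, because g and s satisfy monic equations over B. *)
  have [||M HM] := @uniform_bound (fun i1 m =>
      forall k1, (k1 < rs)%N -> a ^+ m * (u * (g ^+ i1 * s ^+ k1)) \in B) _ _ rg.
  - by move=> i1 m m' mm h k1 /h; apply: mono.
  - move=> i1; apply: (@uniform_bound (fun k1 m => a ^+ m * (u * (g ^+ i1 * s ^+ k1)) \in B)).
      by move=> k1 m m'; apply: mono.
    by move=> k1; apply: lift2.
  have JM : J (a ^+ M * u).
    split=> [|i1 k1]; first by rewrite rpredM // rpredX // OS.
    have [Rg RgB [sRg ->]] := redg i1; have [Rs RsB [sRs ->]] := reds k1.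
    rewrite (horner_coef_wide _ sRg) (horner_coef_wide _ sRs).
    rewrite mulr_suml mulr_sumr; apply: rpred_sum => i2 _.
    rewrite mulr_sumr mulr_sumr; apply: rpred_sum => k2 _.
    have -> : a ^+ M * u * (Rg`_i2 * g ^+ i2 * (Rs`_k2 * s ^+ k2)) =
       Rg`_i2 * Rs`_k2 * (a ^+ M * (u * (g ^+ i2 * s ^+ k2))) by ring.
    apply: rpredM; last exact: HM.
    by apply: rpredM; [apply: (polyOverP RgB)|apply: (polyOverP RsB)].
  have [Pa|//] := PA _ _ (rpredX M (OS _ aO)) uS (JP _ JM).
  elim: M Pa {HM JM} => [|M IHM]; first by rewrite expr0; case: Pprime.
  by rewrite exprS => /(PA _ _ (OS _ aO) (rpredX M (OS _ aO)))[].
have [[P0 PS PD PMl] _ _] := Pprime.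
have PF' : P (F - a *: 'X^((size F).-1)).[x].
  rewrite hornerD hornerN hornerZ hornerXn -mulNr; apply: PD => //.
  rewrite mulrC; apply: (PMl); first by rewrite rpredX.
  by rewrite -mulN1r; apply: PMl => //; rewrite rpredN rpred1.
have sF' : (size (F - a *: 'X^((size F).-1))%R <= n)%N.
  apply/leq_sizeP => k nk; rewrite coefB coefZ coefXn.
  have [->|kn] := eqVneq k (size F).-1; first by rewrite mulr1 -lead_coefE subrr.
  rewrite mulr0 subr0 nth_default //; move: kn nk sF.
  by case: (size F) => // q /= kn nk; rewrite ltnS => qn; rewrite ltn_neqAle eq_sym kn (leq_trans qn).
have F'O : F - a *: 'X^((size F).-1) \is a polyOver O.
  by rewrite rpredB // polyOverZ ?polyOverXn.
have := IHn _ sF' F'O PF' i; rewrite coefB coefZ coefXn.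
have [->|_] := eqVneq i (size F).-1; first by rewrite -lead_coefE.
by rewrite mulr0 subr0.
Qed.

End QuasiFinite.

(** * Non-infinitesimal specialisations *)

Lemma exp_small (R : realType) (q r : R) : 0 <= q -> q < 1 -> 0 < r -> exists n, q ^+ n <= r.
Proof.
rewrite le_eqVlt => /predU1P[<-|q0] q1 r0; first by exists 1%N; rewrite expr1 ltW.
have h0 : 0 < q^-1 - 1 by rewrite subr_gt0 invf_gt1.
have bern n : 1 + n%:R * (q^-1 - 1) <= q^-1 ^+ n.
  elim: n => [|n IHn]; first by rewrite mul0r addr0.
  rewrite exprS; apply: le_trans (ler_wpM2l (ltW _) IHn); last by rewrite invr_gt0.
  rewrite -subr_ge0 (_ : _ - _ = n%:R * (q^-1 - 1) ^+ 2); last by rewrite -natr1; ring.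
  by rewrite mulr_ge0 ?sqr_ge0.
pose n := Num.bound (r^-1 / (q^-1 - 1)); exists n.
have rV0 : 0 < r^-1 by rewrite invr_gt0.
rewrite -[r]invrK -[q]invrK exprVn lef_pV2 ?posrE ?exprn_gt0 ?invr_gt0 //.
apply: le_trans (bern n); have := archi_boundP (ltW (divr_gt0 rV0 h0)).
rewrite ltr_pdivrMr // => /ltW h; apply: le_trans h _.
by rewrite lerDr.
Qed.

Lemma mx_mulN (K : fieldType) (V : valring K) a b : a \in V -> b \in V ->
  ~~ mx V a -> ~~ mx V b -> ~~ mx V (a * b).
Proof. by move=> aV bV na nb; rewrite mxMP // negb_or na. Qed.

Section UnitCoefficients.
Variables (K : fieldType) (V : valring K).

Lemma unit_coef_exp (P : {poly K}) n : P \is a polyOver V -> (exists i, ~~ mx V P`_i) ->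
  exists i, ~~ mx V (P ^+ n)`_i.
Proof.
move=> PV Pu; elim: n => [|n IHn]; first by exists 0%N; rewrite expr0 coef1 mx1.
have [i [ni imin]] := first_unit_coef Pu; have [j [nj jmin]] := first_unit_coef IHn.
by exists (i + j)%N; rewrite exprS; apply: unit_coef_mul => //; apply: rpredX.
Qed.

End UnitCoefficients.

Section Density.
Variables (k K : fieldType) (R : realType) (v : nonarch_abs k R) (io : {rmorphism k -> K}).
Variables (V : valring K) (C : subringClosed K).
Hypothesis CV : {subset C <= V}.
Hypothesis okC : forall a, v a <= 1 -> io a \in C.
Hypothesis kV : forall a, io a \in V -> v a <= 1.

(* On F the valuation V has the value group of k, and its units are quotients
   of elements of C. *)
Definition gauss_like (F : subringClosed K) :=
  [/\ inv_closed F, forall a, io a \in F & forall u, u \in F -> u != 0 ->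
    exists e a d, [/\ e != 0, [/\ a \in C, a \in F & ~~ mx V a],
      [/\ d \in C, d \in F & ~~ mx V d] & u = io e * a / d]].

Lemma gauss_like_integral F u : gauss_like F -> u \in F -> u \in V ->
  exists d, [/\ d \in C, d \in F, ~~ mx V d & [/\ d * u \in C & d * u \in F]].
Proof.
move=> [_ kF FE] uF uV; have [->|u0] := eqVneq u 0.
  by exists 1; rewrite !rpred1 mx1 mulr0 !rpred0.
have [e [a [d [e0 [aC aF na] [dC dF nd] uE]]]] := FE u uF u0.
have [a0 aVV] := mx_unit na; have [d0 dVV] := mx_unit nd.
have ioeV : io e \in V.
  have -> : io e = u * (d * a^-1) by rewrite uE; field; apply/andP.
  by apply: rpredM => //; apply: rpredM => //; apply: CV.
have du : d * u = io e * a by rewrite uE mulrC divfK.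
by exists d; split=> //; rewrite du !rpredM ?okC ?kV.
Qed.

Lemma gauss_like_poly F (P : {poly K}) : gauss_like F -> P \is a polyOver F -> P \is a polyOver V ->
  exists d, [/\ d \in C, d \in F, ~~ mx V d & d *: P \is a polyOver C /\ d *: P \is a polyOver F].
Proof.
move=> FG PF PV.
suff [d [dC dF nd dP]] : exists d, [/\ d \in C, d \in F, ~~ mx V d &
    forall i, (i < size P)%N -> d * P`_i \in C /\ d * P`_i \in F].
  exists d; split=> //; split; apply/polyOverP => i; rewrite coefZ.
    by have [/dP[]//|si] := ltnP i (size P); rewrite nth_default // mulr0 rpred0.
  by have [/dP[]//|si] := ltnP i (size P); rewrite nth_default // mulr0 rpred0.
elim: (size P) => [|n [d [dC dF nd dP]]]; first by exists 1; rewrite !rpred1 mx1.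
have [d' [d'C d'F nd' [dPC dPF]]] := gauss_like_integral FG (polyOverP PF n) (polyOverP PV n).
exists (d * d'); split; rewrite ?rpredM //; first by apply: mx_mulN; rewrite ?CV.
move=> i; rewrite ltnS leq_eqVlt => /predU1P[->|/dP[iC iF]].
  by rewrite -mulrA; split; apply: rpredM.
by rewrite mulrAC; split; apply: rpredM.
Qed.

Lemma gauss_like_base : exists F, gauss_like F.
Proof.
have [|||F FE] := @subringP K (fun z => exists a, z = io a).
- by exists 1; rewrite rmorph1.
- by move=> _ _ [a ->] [b ->]; exists (a - b); rewrite rmorphB.
- by move=> _ _ [a ->] [b ->]; exists (a * b); rewrite rmorphM.
exists F; split.
- by move=> _ /FE[a ->]; apply/FE; exists a^-1; rewrite fmorphV.
- by move=> a; apply/FE; exists a.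
- move=> _ /FE[a ->]; rewrite fmorph_eq0 => a0.
  by exists a, 1, 1; rewrite !rpred1 mx1 divr1 mulr1.
Qed.

(** A generator either has a residual relation over the field built so far or is adjoined to it. In
    the second case a primitive polynomial takes a unit value at x, so V is the Gauss extension on
    F(x): values are contents, and the field stays [gauss_like]. *)
Lemma residually_algebraic (xs : seq K) : {subset xs <= C} -> exists F, gauss_like F /\
  forall x, x \in xs -> exists Q : {poly K}, [/\ Q \is a polyOver C, Q \is a polyOver F,
    exists i, ~~ mx V Q`_i & mx V Q.[x]].
Proof.
elim: xs => [|x xs IHxs] xsC; first by have [F FG] := gauss_like_base; exists F.
have [|F [FG Falg]] := IHxs; first by move=> y yxs; apply: xsC; rewrite inE yxs orbT.
have xC : x \in C by apply: xsC; rewrite inE eqxx.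
have xV := CV xC.
have [[Q [QF QV [i ni] Qx]]|ntr] := pselect (exists Q : {poly K},
    [/\ Q \is a polyOver F, Q \is a polyOver V, exists i, ~~ mx V Q`_i & mx V Q.[x]]).
  exists F; split=> // y; rewrite inE => /predU1P[->|]; last exact: Falg.
  have [d [dC dF nd [dQC dQF]]] := gauss_like_poly FG QF QV.
  exists (d *: Q); split=> //.
    exists i; rewrite coefZ; apply: mx_mulN => //; first exact: CV.
    exact: (polyOverP QV).
  by rewrite hornerZ; apply: mxMl => //; apply: CV.
have nx (Q : {poly K}) i : Q \is a polyOver F -> Q \is a polyOver V -> ~~ mx V Q`_i -> ~~ mx V Q.[x].
  by move=> QF QV ni; apply/negP => mQ; apply: ntr; exists Q; split=> //; exists i.
have [Finv kF FE] := FG.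
have prim (Q : {poly K}) : Q \is a polyOver F -> Q != 0 -> exists c, [/\ c \in F, c != 0,
    c^-1 *: Q \is a polyOver F, c^-1 *: Q \is a polyOver V & ~~ mx V (c^-1 *: Q).[x]].
  move=> QF Q0; have [c [j [c0 cQV cj]]] := primitive_part V Q0.
  have cE : c = Q`_j by rewrite -[LHS]mulr1 -cj mulVKf.
  have cF : c \in F by rewrite cE (polyOverP QF).
  have cQF : c^-1 *: Q \is a polyOver F by rewrite polyOverZ ?Finv.
  by exists c; split=> //; apply: (nx _ j) => //; rewrite coefZ cj mx1.
have Ftr : transcendental_over F x.
  move=> Q QF Qx; apply/eqP; apply: contraT => Q0.
  by have [c [_ _ _ _]] := prim Q QF Q0; rewrite hornerZ Qx mulr0 mx0.
have [F' [F'inv F'E]] := line_fractions Ftr.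
have FF' : {subset F <= F'}.
  move=> z zF; apply/F'E; exists z%:P, 1.
  by rewrite polyOverC zF rpred1 oner_neq0 !hornerC divr1.
have xF' : x \in F'.
  by apply/F'E; exists 'X, 1; rewrite polyOverX rpred1 oner_neq0 hornerX hornerC divr1.
have ev (Q : {poly K}) : Q \is a polyOver F -> Q != 0 ->
    exists e a d, [/\ e != 0, [/\ a \in C, a \in F' & ~~ mx V a],
      [/\ d \in C, d \in F' & ~~ mx V d] & Q.[x] = io e * a / d].
  move=> QF Q0; have [c [cF c0 cQF cQV nc]] := prim Q QF Q0.
  have [d [dC dF nd [dQC dQF]]] := gauss_like_poly FG cQF cQV.
  have [e [a [d' [e0 [aC aF na] [d'C d'F nd'] cE]]]] := FE c cF c0.
  have [d0 _] := mx_unit nd; have [d'0 _] := mx_unit nd'.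
  have dQx : (d *: (c^-1 *: Q)).[x] = d * (c^-1 *: Q).[x] by rewrite hornerZ.
  have dQxC : (d *: (c^-1 *: Q)).[x] \in C by rewrite horner_over.
  exists e, (a * (d *: (c^-1 *: Q)).[x]), (d' * d); split=> //.
  - split; first by rewrite rpredM.
      by apply: rpredM; [apply: FF'|apply: horner_over => //; apply: polyOverS dQF].
    apply: mx_mulN; rewrite ?CV // dQx; apply: mx_mulN => //; first exact: CV.
    by apply: horner_over.
  - split; [by rewrite rpredM|by apply: FF'; rewrite rpredM|].
    by apply: mx_mulN; rewrite ?CV.
  - rewrite dQx hornerZ; transitivity (c * (c^-1 * Q.[x])); first by rewrite mulVKf.
    by rewrite {1}cE; field; rewrite ?c0 ?d0 ?d'0.
have kF' a : io a \in F' by apply: FF'.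
exists F'; split; last first.
  move=> y; rewrite inE => /predU1P[->|/Falg[Q [QC QF Qu Qy]]]; last first.
    by exists Q; split=> //; apply: polyOverS QF.
  (* A generator that was adjoined now satisfies a linear relation. *)
  exists ('X - x%:P); rewrite !polyOverXsubC !hornerE subrr mx0; split=> //.
  by exists 1%N; rewrite coefB coefX coefC subr0 mx1.
split=> // u /F'E[a [b [aF bF b0 ->]]] u0.
have a0 : a != 0 by apply: contraNneq u0 => ->; rewrite horner0 mul0r.
have [e [a1 [d1 [e0 [a1C a1F na1] [d1C d1F nd1] ->]]]] := ev a aF a0.
have [e' [a2 [d2 [e'0 [a2C a2F na2] [d2C d2F nd2] ->]]]] := ev b bF b0.
have [a20 _] := mx_unit na2; have [d10 _] := mx_unit nd1.
have [d20 _] := mx_unit nd2.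
exists (e / e'), (a1 * d2), (d1 * a2); split; first by rewrite mulf_neq0 ?invr_eq0.
- by rewrite !rpredM //; split=> //; apply: mx_mulN; rewrite ?CV.
- by rewrite !rpredM //; split=> //; apply: mx_mulN; rewrite ?CV.
- have ioe' : io e' != 0 by rewrite fmorph_eq0.
  by rewrite fmorph_div; field; rewrite ?a20 ?d10 ?d20 ?ioe'.
Qed.

End Density.

Section Approximation.
Variables (k K : fieldType) (R : realType) (v : nonarch_abs k R) (io : {rmorphism k -> K}).
Variables (V : valring K) (C : subringClosed K).
Hypothesis CV : {subset C <= V}.
Hypothesis okC : forall a, v a <= 1 -> io a \in C.
Hypothesis kV : forall a, io a \in V -> v a <= 1.
Variables (be c : K) (pi : k).
Hypotheses (pi0 : pi != 0) (mbe : mx V be) (becE : be * c = io pi).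
Hypothesis beinf : forall M, be ^+ M / io pi \notin V.

Lemma nabs_gt0 a : a != 0 -> 0 < v a.
Proof.
move=> a0; rewrite lt_def nabs_ge0 andbT; apply: contraNneq a0 => va.
by apply/eqP/(nabs_eq0 v).
Qed.

Lemma nabsX a n : v (a ^+ n) = v a ^+ n.
Proof. by elim: n => [|n IHn]; rewrite ?expr0 ?nabs1 // !exprS nabsM IHn. Qed.

Lemma nabsV a : v a^-1 = (v a)^-1.
Proof.
have [->|a0] := eqVneq a 0.
  by rewrite invr0 (nabs_eq0 v 0).2 // invr0.
apply: (mulfI (lt0r_neq0 (nabs_gt0 a0))).
by rewrite -nabsM !divff ?nabs1 ?lt0r_neq0 ?nabs_gt0.
Qed.

(** The value of u is that of some e in k with |e| < 1, and pi divides some [e ^+ l] in o_k. If e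
    divided [be ^+ n] in V, then pi would divide [be ^+ (n * l)], against [beinf]. *)
Lemma infinitesimal_uniformizer F u n : gauss_like io V C F -> u \in F -> mx V u ->
  mx V (u / be ^+ n).
Proof.
move=> [Finv kF FE] uF mu; have [->|u0] := eqVneq u 0; first by rewrite mul0r mx0.
have [e [a [d [e0 [aC aF na] [dC dF nd] uE]]]] := FE u uF u0.
have [a0 aVV] := mx_unit na; have [d0 dVV] := mx_unit nd.
have ioe0 : io e != 0 by rewrite fmorph_eq0.
have iopi0 : io pi != 0 by rewrite fmorph_eq0.
have be0 : be != 0.
  by apply: contraNneq iopi0 => be0; rewrite -becE be0 mul0r.
have me : mx V (io e).
  have -> : io e = d / a * u by rewrite uE; field; apply/andP.
  by apply: mxMl => //; apply: rpredM => //; apply: CV.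
have ve : v e < 1.
  rewrite ltNge; apply/negP => ve; move: me; rewrite /mx (negbTE ioe0) /= -fmorphV.
  by move/negP; apply; apply: CV; apply: okC; rewrite nabsV invf_le1 // nabs_gt0.
have [l hl] := exp_small (nabs_ge0 v e) ve (nabs_gt0 pi0).
have elV : io (e ^+ l / pi) \in V.
  apply: CV; apply: okC; rewrite nabsM nabsX nabsV ler_pdivrMr ?mul1r //.
  exact: nabs_gt0.
have mq : mx V (io e / be ^+ n).
  rewrite /mx mulf_eq0 (negbTE ioe0) invr_eq0 expf_eq0 (negbTE be0) andbF /=.
  rewrite invfM invrK; apply/negP => h; move/negP: (beinf (n * l)); apply.
  have -> : be ^+ (n * l) / io pi = ((io e)^-1 * be ^+ n) ^+ l * io (e ^+ l / pi).
    rewrite fmorph_div rmorphXn exprMn exprVn -exprM.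
    by field; rewrite iopi0 expf_neq0.
  by apply: rpredM => //; apply: rpredX.
have -> : u / be ^+ n = a / d * (io e / be ^+ n).
  by rewrite uE; field; rewrite d0 expf_neq0.
by apply: mxMl => //; apply: rpredM => //; apply: CV.
Qed.

(** Nonunits of F are negligible against every power of be, so in a primitive polynomial the first
    unit coefficient dominates the value at be. *)
Lemma infinitesimal_transcendental F : gauss_like io V C F -> transcendental_over F be.
Proof.
move=> FG Q QF Qx; apply/eqP; apply: contraT => Q0; have [Finv kF FE] := FG.
have [u [j [u0 uQV uj]]] := primitive_part V Q0.
have uE : u = Q`_j by rewrite -[LHS]mulr1 -uj mulVKf.
have uF : u \in F by rewrite uE (polyOverP QF).
have uQF : u^-1 *: Q \is a polyOver F by rewrite polyOverZ ?Finv.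
have [|i0 [ni0 i0min]] := @first_unit_coef _ V (u^-1 *: Q).
  by exists j; rewrite coefZ uj mx1.
set P := u^-1 *: Q in uQV uQF ni0 i0min.
have Px : P.[be] = 0 by rewrite hornerZ Qx mulr0.
have iopi0 : io pi != 0 by rewrite fmorph_eq0.
have be0 : be != 0 by apply: contraNneq iopi0 => be0; rewrite -becE be0 mul0r.
have si0 : (i0 < size P)%N.
  by rewrite ltnNge; apply: contra ni0 => h; rewrite nth_default ?mx0.
have : mx V (P.[be] / be ^+ i0 - P`_i0); last first.
  by rewrite Px mul0r sub0r => /mxN; rewrite opprK (negbTE ni0).
rewrite horner_coef (bigD1 (Ordinal si0)) //= mulrDl mulfK ?expf_neq0 // addrC addKr.
rewrite mulr_suml; apply: mx_sum => i ii0.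
have : (i < i0)%N || (i0 < i)%N.
  by rewrite -neq_ltn; apply: contraNneq ii0 => e; apply/eqP/val_inj.
case/orP => hi.
  rewrite mulrAC; apply: mxMr; first by rewrite rpredX ?mx_in.
  by apply: (infinitesimal_uniformizer _ FG); [apply: (polyOverP uQF)|apply: i0min].
have -> : be ^+ i = be ^+ (i - i0) * be ^+ i0 by rewrite -exprD subnK // ltnW.
rewrite mulrA mulfK ?expf_neq0 //; apply: mxMl; first exact: (polyOverP uQV).
by rewrite mxXP ?mx_in // subn_gt0 hi.
Qed.

(* The other factor c = pi / be has a pole at be = 0, while the line with
   coordinate be is normal. *)
Lemma pole_not_integral F b : gauss_like io V C F ->
    b \in clr (base_and V F be) -> b * c \in clr (base_and V F be) -> mx V b.
Proof.
move=> FG bcl bccl; have [Finv kF FE] := FG.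
have tr := infinitesimal_transcendental FG.
have [mu [mum mub muP muY]] := integral_over_line Finv tr bcl.
have iopi0 : io pi != 0 by rewrite fmorph_eq0.
have [S SE] := eval_ring F be.
pose M z := exists2 P, P \is a polyOver F & z = P.[be] * be.
(* Y contains the field F and has be in its maximal ideal: it extends the valuation of the line at
   the point be = 0. *)
have [||Y [SY MY]] := @dominate _ S M.
- split.
  + by exists 0; rewrite ?rpred0 // horner0 mul0r.
  + by move=> _ [P PF ->]; apply/SE; exists (P * 'X); rewrite ?rpredM ?polyOverX // hornerM hornerX.
  + by move=> _ _ [P PF ->] [Q QF ->]; exists (P + Q); rewrite ?rpredD // hornerD mulrDl.
  + by move=> _ _ /SE[Q QF <-] [P PF ->]; exists (Q * P); rewrite ?rpredM // hornerM mulrA.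
- move=> [P PF P1]; have PF' : 1 - P * 'X \is a polyOver F by rewrite rpredB ?rpred1 ?rpredM ?polyOverX.
  have := tr _ PF'; rewrite hornerD hornerN hornerM hornerX -P1 hornerC subrr => /(_ erefl).
  move=> /(congr1 (fun P : {poly K} => P`_0)); rewrite coefB coefMX coef1 coef0 subr0 /=.
  by move/eqP; rewrite oner_eq0.
have FY : {subset F <= Y}.
  by move=> z zF; apply/SY/SE; exists z%:P; rewrite ?polyOverC ?hornerC.
have mY : mx Y be by apply: MY; exists 1; rewrite ?rpred1 // hornerC mul1r.
have XY z : base_and V F be z -> z \in Y by case=> [[/FY]|->] //; apply: mx_in.
have npi z : z \in F -> z != 0 -> ~~ mx Y z.
  by move=> zF z0; rewrite /mx (negbTE z0) negbK FY ?Finv.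
apply: (monic_root_mx mum mub).
  by apply: (cl_vring bcl) => z [[]|->] //; apply: mx_in.
move=> i isz.
have mi : mx Y mu`_i.
  (* The relation b pi = be (b c): at be = 0 the constant pi is a unit, while the coordinate
     vanishes. *)
  apply: (muY Y (io pi)%:P 'X (b * c) XY) => //; rewrite ?polyOverC ?polyOverX ?hornerC ?hornerX ?npi ?FY //.
  by rewrite -becE mulrCA.
have [P [PF PV Pi]] := muP i; rewrite Pi in mi *.
have split0 : P.[be] - P`_0 = \sum_(j < (size P).-1) P`_j.+1 * be ^+ j * be.
  rewrite (@horner_coef_wide _ (size P).-1.+1) ?leqSpred // big_ord_recl /= expr0 mulr1.
  by rewrite addrC addKr; apply: eq_bigr => j _; rewrite exprSr mulrA.
(* Nonzero elements of F are units of Y, so the constant term is 0 and [P.[be]] is be times an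
   element of V. *)
have P0 : P`_0 = 0.
  apply/eqP; apply: contraT => /(npi _ (polyOverP PF 0%N)) /negP[].
  rewrite -(subKr P.[be] P`_0); apply: mxD mi _; apply: mxN; rewrite split0.
  apply: mx_sum => j _; apply: mxMl => //.
  by apply: rpredM; [apply/FY/(polyOverP PF)|apply/rpredX/mx_in].
rewrite P0 subr0 in split0; rewrite split0; apply: mx_sum => j _; apply: mxMl => //.
by apply: rpredM; [apply: (polyOverP PV)|apply/rpredX/mx_in].
Qed.

Hypothesis cC : c \in C.
Hypothesis beC : be \in C.

(** Organised as a descent: generators are dropped from xs while C stays in the localised integral
    closure of what is left. A generator that could not be dropped would contradict
    [fiber_not_isolated], and dropping all of them contradicts [pole_not_integral]. The last
    hypothesis is minimality over be of the centre of V on C. *)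
Lemma not_infinitesimal (xs : seq K) : {subset xs <= C} ->
    (forall z, z \in C -> z \in genr (fun z => (exists2 a, v a <= 1 & z = io a) \/ z \in xs)) ->
    (forall f, f \in C -> mx V f -> exists g n s,
       [/\ g \in C, ~~ mx V g, s \in C & g * f ^+ n = be * s]) ->
  False.
Proof.
move=> xsC Cgen Qmin.
have [F [FG Falg]] := residually_algebraic CV okC kV xsC; have [Finv kF FE] := FG.
pose X (l : seq K) z := base_and V F be z \/ z \in l.
(* Membership in the integral closure of the ring generated by [X l], localised at the centre of
   V. *)
pose near l y := exists b, [/\ b \in clr (X l), ~~ mx V b & b * y \in clr (X l)].
have XV l : {subset l <= xs} -> forall z, X l z -> z \in V.
  by move=> lxs z [[[]|->]|/lxs/xsC/CV] //; apply: mx_in.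
have clV l : {subset l <= xs} -> {subset clr (X l) <= V}.
  by move=> lxs z /cl_vring; apply; apply: XV.
have start : forall y, y \in C -> near xs y.
  move=> y yC; exists 1; rewrite rpred1 mx1 mul1r; split=> //.
  move: y {yC} (Cgen y yC); apply: gen_sub => z [[a va ->]|zxs].
    by apply: cl_in; left; left; split; [apply: kF|apply/CV/okC].
  by apply: cl_in; right.
suff : forall l, {subset l <= xs} -> (forall y, y \in C -> near l y) -> False.
  by move=> /(_ xs); apply.
elim=> [|x l IHl] lxs Cl.
  have [b [bcl nb bccl]] := Cl c cC; move/negP: nb; apply.
  have E z : X [::] z -> z \in clr (base_and V F be) by case=> // h; apply: cl_in.
  by apply: (pole_not_integral FG); apply: (cl_trans _ E).
have l'xs : {subset l <= xs} by move=> z zl; apply: lxs; rewrite inE zl orbT.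
have xxs : x \in xs by apply: lxs; rewrite inE eqxx.
have xV : x \in V by apply/CV/xsC.
have OV := clV l l'xs.
have [[b [bO nb bxO]]|nx] := pselect (exists b, [/\ b \in clr (X l), ~~ mx V b & b * x \in clr (X l)]).
  apply: (IHl l'xs) => y /Cl[e [eO ne eyO]].
  have clear z : z \in clr (X (x :: l)) -> exists n, b ^+ n * z \in clr (X l).
    apply: cl_clear_denominators => // w [bw|]; first by exists 0%N; rewrite mul1r cl_in //; left.
    rewrite inE => /predU1P[->|wl]; first by exists 1%N.
    by exists 0%N; rewrite mul1r cl_in //; right.
  have [n hn] := clear _ eO; have [m hm] := clear _ eyO.
  exists (b ^+ (n + m) * e); split.
  - by rewrite addnC exprD -mulrA rpredM // rpredX.
  - apply: mx_mulN => //; first by rewrite rpredX // OV.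
      by apply: (clV _ lxs).
    by rewrite mxXP ?OV // (negbTE nb) andbF.
  - by rewrite exprD -!mulrA rpredM // rpredX.
pose O : subringClosed K := GRing.SubringClosed.clone K (clr (X l)) _.
have Ocl : int_closed O.
  by move=> y /clP yO; apply: (cl_trans yO).
have [Q [QC QF Qu Qx]] := Falg x xxs.
(* Minimality, applied to the residual relation of x, gives g Q(x)^n = be s. The multipliers e1 and
   e2 below make both sides integral over O[x]. *)
have [g [n [s [gC ng sC e]]]] := Qmin _ (horner_over QC (xsC _ xxs)) Qx.
have [e1 [e1O ne1 ge1]] := Cl g gC; have [e2 [e2O ne2 se2]] := Cl s sC.
have adjO z : z \in clr (X (x :: l)) -> cl (adj O x) z.
  move=> zcl; apply/clP; apply: (cl_trans zcl) => w [bw|].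
    by apply: cl_in; left; apply: cl_in; left.
  rewrite inE => /predU1P[->|wl]; first by apply: cl_in; right.
  by apply: cl_in; left; apply: cl_in; right.
have QV : Q \is a polyOver V by apply: polyOverS QC.
have QO : Q \is a polyOver O.
  apply/polyOverP => i; apply: cl_in; left; left; split; first exact: (polyOverP QF).
  exact: (polyOverP QV).
have : mx V (e1 * e2 * g).
  apply: (@fiber_not_isolated K V O x Ocl OV xV _ be (Q ^+ n) (e1 * e2 * g) (e1 * e2 * s)).
  - by move=> b bO nb; apply/negP => bxO; apply: nx; exists b.
  - by apply: cl_in; left; right.
  - by [].
  - by rewrite rpredX.
  - exact: unit_coef_exp.
  - by apply: adjO; rewrite mulrAC mulrC rpredM.
  - by apply: adjO; rewrite -mulrA rpredM.
  - by rewrite horner_exp -[LHS]mulrA e mulrCA.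
apply/negP; have e1V := clV _ lxs _ e1O; have e2V := clV _ lxs _ e2O.
by apply: mx_mulN => //; [apply: rpredM|apply: CV|apply: mx_mulN].
Qed.

End Approximation.

(** * The seminorm of a valuation ring *)

Section Seminorm.
Variables (k K : fieldType) (R : realType) (v : nonarch_abs k R) (io : {rmorphism k -> K}).
Variables (V : valring K) (pi : k).
Hypothesis kV : forall a, io a \in V <-> v a <= 1.
Hypotheses (pi0 : pi != 0) (vpi : v pi < 1).

(** Comparing |a| with [r ^+ n] avoids roots; powers of y account for values of V that fall between
    those of k. *)
Definition radius y r :=
  0 <= r /\ exists n a w, [/\ (0 < n)%N, w \in V, y ^+ n = io a * w & v a <= r ^+ n].

Definition seminorm y : R := inf [set r | radius y r]%classic.

(** Ensures that there is some radius: the infimum of the empty set would be 0 by default. *)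
Definition bounded_elt y := exists a, a != 0 /\ io a * y \in V.

Lemma radius_lbound y : has_lbound [set r | radius y r]%classic.
Proof. by exists 0 => r []. Qed.

Lemma bounded_radius y : bounded_elt y -> exists r, radius y r.
Proof.
move=> [a [a0 ayV]]; exists (v a^-1); split; first exact: nabs_ge0.
exists 1%N, a^-1, (io a * y); rewrite !expr1; split=> //.
by rewrite mulrA -rmorphM mulVf // rmorph1 mul1r.
Qed.

Lemma seminorm_le y r : radius y r -> seminorm y <= r.
Proof. by move=> yr; apply: (ge_inf (radius_lbound y)). Qed.

Lemma seminorm_lt y r : bounded_elt y -> seminorm y < r -> exists2 t, radius y t & t < r.
Proof.
move=> /bounded_radius[r0 yr0] lt.
have [|t yt tr] := @inf_lt _ [set r | radius y r]%classic r _ lt; last by exists t.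
by exists r0.
Qed.

Lemma seminorm_glb y r : bounded_elt y -> (forall t, radius y t -> r <= t) -> r <= seminorm y.
Proof.
by move=> /bounded_radius[r0 yr0] h; apply: lb_le_inf; [exists r0|move=> t /h].
Qed.

Lemma seminorm_ge0 y : bounded_elt y -> 0 <= seminorm y.
Proof. by move=> by_; apply: seminorm_glb => // t []. Qed.

Lemma boundedM x y : bounded_elt x -> bounded_elt y -> bounded_elt (x * y).
Proof.
move=> [a [a0 ax]] [b [b0 bx]]; exists (a * b); rewrite mulf_neq0 // rmorphM mulrACA.
by rewrite rpredM.
Qed.

Lemma bounded_vring y : y \in V -> bounded_elt y.
Proof. by move=> yV; exists 1; rewrite oner_neq0 rmorph1 mul1r. Qed.

Lemma radius_scale z y r : z \in V -> radius y r -> radius (z * y) r.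
Proof.
move=> zV [r0 [n [a [w [n0 wV e va]]]]]; split=> //; exists n, a, (z ^+ n * w).
by rewrite exprMn e mulrCA; split=> //; rewrite rpredM ?rpredX.
Qed.

Lemma seminorm_scale z y : z \in V -> bounded_elt y -> seminorm (z * y) <= seminorm y.
Proof.
move=> zV yb; apply: seminorm_glb => // t yt; apply: seminorm_le; exact: radius_scale.
Qed.

Lemma seminorm_vring y : y \in V -> seminorm y <= 1.
Proof.
move=> yV; apply: seminorm_le; split=> //; exists 1%N, 1, y.
by rewrite !expr1 rmorph1 mul1r nabs1.
Qed.

Lemma seminorm_base a : seminorm (io a) = v a.
Proof.
have ra : radius (io a) (v a).
  split; first exact: nabs_ge0.
  by exists 1%N, a, 1; rewrite !expr1 mulr1 rpred1.
have ba : bounded_elt (io a).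
  have [->|a0] := eqVneq a 0; first by apply: bounded_vring; rewrite rmorph0 rpred0.
  by exists a^-1; rewrite invr_eq0 -rmorphM mulVf // rmorph1 rpred1.
apply/eqP; rewrite eq_le seminorm_le //=; apply: seminorm_glb => // t [t0 [n [b [w [n0 wV e vb]]]]].
rewrite -(ler_pXn2r n0) ?nnegrE ?nabs_ge0 //; apply: le_trans vb.
have [b0|b0] := eqVneq b 0.
  rewrite b0 rmorph0 mul0r in e; have /eqP := e; rewrite -rmorphXn fmorph_eq0 => /eqP an.
  by rewrite -nabsX an b0.
have : io (a ^+ n / b) \in V by rewrite fmorph_div rmorphXn e mulrAC divff ?mul1r // fmorph_eq0.
move/kV; rewrite nabsM nabsX nabsV ler_pdivrMr ?mul1r //; exact: nabs_gt0.
Qed.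

Lemma seminorm0 : seminorm 0 = 0.
Proof. by rewrite -(rmorph0 io) seminorm_base (nabs_eq0 v 0).2. Qed.

Lemma seminormD x y : bounded_elt x -> bounded_elt y -> seminorm (x + y) <= seminorm x + seminorm y.
Proof.
wlog : x y / y == 0 \/ x / y \in V => [th bx by_|].
  have [y0|y0] := eqVneq y 0; first by apply: th => //; left; apply/eqP.
  have [x0|x0] := eqVneq x 0; first by rewrite addrC [X in _ <= X]addrC; apply: th => //; left; apply/eqP.
  have /orP[h|h] := valringP V (mulf_neq0 x0 (invr_neq0 y0)); first by apply: th => //; right.
  rewrite addrC [X in _ <= X]addrC; apply: th => //; right.
  by rewrite invfM invrK mulrC in h.
move=> [/eqP->|xyV] bx by_; first by rewrite addr0 seminorm0 addr0.
have [y0|y0] := eqVneq y 0; first by rewrite y0 addr0 seminorm0 addr0.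
have -> : x + y = (x / y + 1) * y by rewrite mulrDl mul1r divfK.
apply: le_trans (seminorm_scale _ by_) _; first by rewrite rpredD ?rpred1.
by rewrite lerDr seminorm_ge0.
Qed.

Lemma radiusM x y r t : radius x r -> radius y t -> radius (x * y) (r * t).
Proof.
move=> [r0 [n [a [w [n0 wV e va]]]]] [t0 [m [b [w' [m0 w'V e' vb]]]]].
split; first exact: mulr_ge0.
exists (n * m)%N, (a ^+ m * b ^+ n), (w ^+ m * w' ^+ n); split.
- by rewrite muln_gt0 n0.
- by rewrite rpredM ?rpredX.
- by rewrite exprMn exprM e [(n * m)%N]mulnC exprM e' !exprMn rmorphM !rmorphXn mulrACA.
- rewrite nabsM !nabsX exprMn exprM [(n * m)%N]mulnC exprM.
  by apply: ler_pM; rewrite ?exprn_ge0 ?nabs_ge0 // lerXn2r ?nnegrE ?exprn_ge0 ?nabs_ge0.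
Qed.

(** The values of k may be discrete, so rho is approximated only up to a factor |pi|. The loss does
    not grow with rho, which makes it harmless for high powers. *)
Lemma nabs_between rho : 0 < rho -> exists c, [/\ c != 0, v pi * rho <= v c & v c <= rho].
Proof.
move=> rho0; have vpi0 := nabs_gt0 v pi0.
have [le1|gt1] := leP rho 1.
  have [n0 hn0] := exp_small (ltW vpi0) vpi rho0.
  have ex : exists n, v pi ^+ n <= rho by exists n0.
  case: (ex_minnP ex) => -[|n] hn nmin.
    exists 1; rewrite oner_neq0 nabs1 -(expr0 (v pi)) hn; split=> //.
    by rewrite mulr_ile1 // ltW.
  exists (pi ^+ n.+1); rewrite expf_neq0 // nabsX; split=> //.
  rewrite exprS ler_pM2l // ltW // ltNge; apply/negP => /nmin; by rewrite ltnn.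
have rhoV0 : 0 < rho^-1 by rewrite invr_gt0.
have [n0 hn0] := exp_small (ltW vpi0) vpi rhoV0.
have ex : exists n, v pi ^+ n <= rho^-1 by exists n0.
case: (ex_minnP ex) => -[|n] hn nmin.
  have lt1 : rho^-1 < 1 by rewrite invf_lt1.
  by have := le_lt_trans hn lt1; rewrite expr0 ltxx.
exists (pi ^- n); rewrite invr_eq0 expf_neq0 // nabsV nabsX; split=> //.
  rewrite -[X in X <= _]invrK lef_pV2 ?posrE ?invr_gt0 ?mulr_gt0 ?exprn_gt0 //.
  by rewrite invfM ler_pdivlMl // -exprS.
rewrite -[X in _ <= X]invrK lef_pV2 ?posrE ?exprn_gt0 // ltW // ltNge.
by apply/negP => /nmin; rewrite ltnn.
Qed.

Lemma product_above (p q g : R) : 0 <= p -> 0 <= q -> p * q < g ->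
  exists r t, [/\ p < r, q < t & r * t < g].
Proof.
(* As d is at most 1, (p + d)(q + d) exceeds p q by at most d (p + q + 1); the 2 in the denominator
   makes the inequality strict. *)
move=> p0 q0 pqg; pose d := Num.min 1 ((g - p * q) / (p + q + 2)).
have s0 : 0 < p + q + 2 by rewrite ltr_wpDl ?addr_ge0.
have d0 : 0 < d by rewrite lt_min ltr01 divr_gt0 // subr_gt0.
have d1 : d <= 1 by rewrite ge_min lexx.
have dg : d * (p + q + 2) <= g - p * q by rewrite -ler_pdivlMr // ge_min lexx orbT.
exists (p + d), (q + d); rewrite !ltrDl d0; split=> //.
rewrite -subr_gt0; have -> : g - (p + d) * (q + d) = (g - p * q - d * (p + q + 2)) + d * (2 - d) by ring.
rewrite ltr_wpDl ?subr_ge0 // mulr_gt0 // subr_gt0 (le_lt_trans d1) //.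
by rewrite ltr1n.
Qed.

Lemma product_below (p q g : R) : 0 <= p -> 0 <= q -> 0 <= g -> g < p * q ->
  exists r t, [/\ 0 < r, 0 < t, r < p, t < q & g < r * t].
Proof.
move=> p0 q0 g0 gpq.
have pq0 : 0 < p * q by apply: le_lt_trans gpq.
have pp : 0 < p by rewrite lt_def p0 andbT; apply: contraTneq pq0 => ->; rewrite mul0r ltxx.
have qp : 0 < q by rewrite lt_def q0 andbT; apply: contraTneq pq0 => ->; rewrite mulr0 ltxx.
(* Inversion reduces the claim to [product_above]; the midpoint replaces g, which may be 0. *)
have [|||r [t [pr qt rt]]] := @product_above p^-1 q^-1 ((g + p * q) / 2)^-1.
- by rewrite invr_ge0.
- by rewrite invr_ge0.
- by rewrite -invfM ltf_pV2 ?posrE ?divr_gt0 ?ltr_wpDl // midf_lt.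
have r0 : 0 < r by apply: lt_trans pr; rewrite invr_gt0.
have t0 : 0 < t by apply: lt_trans qt; rewrite invr_gt0.
exists r^-1, t^-1; rewrite !invr_gt0 r0 t0; split=> //.
- by rewrite -[p]invrK ltf_pV2 ?posrE ?invr_gt0.
- by rewrite -[q]invrK ltf_pV2 ?posrE ?invr_gt0.
have mid0 : 0 < (g + p * q) / 2 by rewrite divr_gt0 ?ltr_wpDl.
have mid : g < (g + p * q) / 2 by rewrite midf_lt.
apply: (lt_trans mid); rewrite -invfM -[X in X < _]invrK.
by rewrite ltf_pV2 // posrE; [rewrite invr_gt0|rewrite mulr_gt0].
Qed.

(** Submultiplicativity is [radiusM]. For the converse, if r1 and r2 lie below the seminorms of x
    and y, then x^n and y^n divide in V elements of k of size about r1^n and r2^n, since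
    divisibility in V is total. A radius of x y below r1 r2 is then impossible for large n. *)
Lemma seminormM x y : bounded_elt x -> bounded_elt y -> seminorm (x * y) = seminorm x * seminorm y.
Proof.
move=> bx by_; have bxy := boundedM bx by_.
have [sx sy sxy] := And3 (seminorm_ge0 bx) (seminorm_ge0 by_) (seminorm_ge0 bxy).
apply/eqP; rewrite eq_le; apply/andP; split; rewrite leNgt; apply/negP => h.
  have [r [t [xr yt rt]]] := product_above sx sy h.
  have [r' xr' r'r] := seminorm_lt bx xr; have [t' yt' t't] := seminorm_lt by_ yt.
  have := seminorm_le (radiusM xr' yt'); apply/negP; rewrite -ltNge.
  apply: le_lt_trans rt; apply: ler_pM; [by case: xr'|by case: yt'|exact: ltW|exact: ltW].
have [r0 [r00 [m [a [w [m0 wV e va]]]]] r0lt] := seminorm_lt bxy h.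
have [r1 [r2 [r1p r2p r1x r2y r12]]] := product_below sx sy r00 r0lt.
have nz z : 0 < seminorm z -> z != 0 by move=> hz; apply: contraTneq hz => ->; rewrite seminorm0 ltxx.
have x0 : x != 0 by apply/nz/lt_trans/r1x.
have y0 : y != 0 by apply/nz/lt_trans/r2y.
have a0 : a != 0.
  apply: contraTneq (expf_neq0 m (mulf_neq0 x0 y0)) => a0.
  by rewrite e a0 rmorph0 mul0r eqxx.
have avoid z r c n : (0 < n)%N -> z != 0 -> 0 <= r -> r < seminorm z ->
    c != 0 -> v c <= r ^+ n -> io c / z ^+ n \in V.
  move=> n0 z0 rge rz c0 vc; apply: contraT => nV.
  have ioc : io c != 0 by rewrite fmorph_eq0.
  have := valringP V (mulf_neq0 ioc (invr_neq0 (expf_neq0 n z0))).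
  rewrite (negbTE nV) /= => iV.
  have : radius z r.
    split=> //; exists n, c, (io c / z ^+ n)^-1; split=> //.
    by rewrite invfM invrK mulVKf.
  by move=> /seminorm_le; rewrite leNgt rz.
have q0 : 0 <= r0 / (r1 * r2) by rewrite divr_ge0 // ltW // mulr_gt0.
have r12p : 0 < r1 * r2 by rewrite mulr_gt0.
have q1 : r0 / (r1 * r2) < 1 by rewrite ltr_pdivrMr // mul1r.
have vpi0 := nabs_gt0 v pi0.
(* The two approximations below cost a factor |pi|^2 together, so a power of the ratio under |pi|^3
   gives the contradiction. *)
have [l hl] := @exp_small _ (r0 / (r1 * r2)) (v pi ^+ 3) q0 q1 (exprn_gt0 3 vpi0).
pose n := (m * l.+1)%N.
have n0 : (0 < n)%N by rewrite muln_gt0 m0.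
have [c1 [c10 c1l c1u]] := nabs_between (exprn_gt0 n r1p).
have [c2 [c20 c2l c2u]] := nabs_between (exprn_gt0 n r2p).
have h1 := avoid x r1 c1 n n0 x0 (ltW r1p) r1x c10 c1u.
have h2 := avoid y r2 c2 n n0 y0 (ltW r2p) r2y c20 c2u.
have : io (c1 * c2 / a ^+ l.+1) \in V.
  have -> : io (c1 * c2 / a ^+ l.+1) = (io c1 / x ^+ n) * (io c2 / y ^+ n) * w ^+ l.+1.
    have exy : x ^+ n * y ^+ n = io a ^+ l.+1 * w ^+ l.+1 by rewrite -exprMn exprM e exprMn.
    rewrite fmorph_div rmorphM rmorphXn mulrACA -invfM exy -[RHS]mulrA; congr (_ * _).
    rewrite invfM divfK //.
    apply: contraTneq (mulf_neq0 (expf_neq0 n x0) (expf_neq0 n y0)) => w0.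
    by rewrite exy w0 mulr0 eqxx.
  by apply: rpredM; [apply: rpredM|apply: rpredX].
move/kV; rewrite nabsM nabsV nabsX nabsM ler_pdivrMr ?mul1r ?exprn_gt0 ?nabs_gt0 // => hc.
have : (v pi * r1 ^+ n) * (v pi * r2 ^+ n) <= r0 ^+ n.
  apply: le_trans (ler_pM _ _ c1l c2l) _; try by rewrite ltW // mulr_gt0 // exprn_gt0.
  apply: le_trans hc _; rewrite exprM lerXn2r ?nnegrE ?exprn_ge0 ?nabs_ge0 //.
rewrite mulrACA -exprMn -ler_pdivlMr ?exprn_gt0 // -expr_div_n.
apply/negP; rewrite -ltNge.
have qn : (r0 / (r1 * r2)) ^+ n <= (r0 / (r1 * r2)) ^+ l.
  apply: ler_wiXn2l => //; first exact: ltW.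
  by rewrite /n; apply: leq_trans (leqnSn _) (leq_pmull _ m0).
apply: le_lt_trans qn _; apply: le_lt_trans hl _.
by rewrite exprSr expr2 gtr_pMr // mulr_gt0.
Qed.

End Seminorm.

(** * Integral elements and Berkovich points *)

Lemma rmorphism_of (A B : nzRingType) (f : A -> B) : f 1 = 1 ->
    (forall x y, f (x - y) = f x - f y) -> (forall x y, f (x * y) = f x * f y) ->
  exists g : {rmorphism A -> B}, forall x, g x = f x.
Proof.
move=> f1 fB fM.
pose fa := GRing.isZmodMorphism.Build A B f fB.
pose fm := GRing.isMonoidMorphism.Build A B f (conj f1 fM).
by exists (HB.pack_for (GRing.RMorphism.type A B) f fa fm).
Qed.

Lemma prime_residue_field (A : comNzRingType) (M : A -> Prop) :
    M 1 -> (forall x y, M x -> M y -> M (x * y)) -> ~ M 0 ->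
  exists (K : fieldType) (f : {rmorphism A -> K}), forall x, M x -> f x != 0.
Proof.
move=> M1 MM M0.
have [|||D DE] := @subringP A (fun=> True) => //.
have inD x : x \in D by apply/DE.
have [||||P [Pprime _ PM _]] := @prime_avoid A D (fun z => z = 0) M _ M1 => //.
- split=> //; first by move=> x y -> ->; rewrite addr0.
  by move=> a x _ ->; rewrite mulr0.
- by move=> x Mx x0; apply: M0; rewrite -x0.
have [K [f [f1 fB fM fP]]] := residue_field Pprime.
have [|||g gE] := @rmorphism_of A K f => //.
- by move=> x y; apply: fB.
- by move=> x y; apply: fM.
exists K, g => x Mx; rewrite gE; apply/eqP => /(fP _ (inD x)); exact: PM.
Qed.

Section Bounded.
Variables (k : fieldType) (R : realType) (v : nonarch_abs k R) (A : comAlgType k) (s : A -> R).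
Hypothesis sP : berkovich_point v s.

(** A point is given as subadditive, so the largest term of the equation cannot be isolated
    directly. Instead, every power of al is a combination of the first N powers with coefficients of
    seminorm at most 1; the powers of [s al] are thus bounded, and [s al] is at most 1. *)
Lemma integral_bounded (B : comNzRingType) (phi : {rmorphism B -> A}) al :
  (forall b, s (phi b) <= 1) -> integralOver phi al -> s al <= 1.
Proof.
have [s0 sD sM sk] := sP.
have s1 : s 1 = 1 by rewrite -[1]scale1r sk nabs1.
have sz : s 0 = 0 by rewrite -[0](scale0r 1) sk (nabs_eq0 v 0).2.
have sX x n : s (x ^+ n) = s x ^+ n by elim: n => [|n IHn]; rewrite ?expr0 // !exprS sM IHn.
move=> phi1 [p pm /rootP pal]; rewrite leNgt; apply/negP => al1.
pose N := size p; pose E := \sum_(i < N) s al ^+ i.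
have E0 : 0 <= E by apply: sumr_ge0 => i _; rewrite exprn_ge0.
have bound m : s al ^+ m <= E.
  rewrite -sX; have /(congr1 (fun q => (map_poly phi q).[al])) := Pdiv.RingMonic.rdivp_eq pm 'X^m.
  rewrite rmorphD rmorphM hornerD hornerM pal mulr0 add0r map_polyXn hornerXn => ->.
  set r := Pdiv.Ring.rmodp _ _.
  have sr : (size (map_poly phi r) <= N)%N.
    apply: leq_trans (size_poly _ _) _; apply: ltnW; apply: Pdiv.Ring.ltn_rmodpN0; exact: monic_neq0.
  rewrite (horner_coef_wide _ sr) /E.
  elim: (N) => [|n IHn]; first by rewrite !big_ord0 sz.
  rewrite !big_ord_recr /=; apply: le_trans (sD _ _) _; apply: lerD => //.
  by rewrite sM sX coef_map; apply: ler_piMl; [apply: exprn_ge0|apply: phi1].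
have al0 : 0 < s al by apply: lt_trans al1.
have E1 : 0 < (E + 1)^-1 by rewrite invr_gt0 ltr_wpDl.
have [||m hm] := @exp_small R (s al)^-1 (E + 1)^-1 _ _ E1.
- by rewrite invr_ge0.
- by rewrite invf_lt1.
move: hm; rewrite exprVn lef_pV2 ?posrE ?exprn_gt0 ?ltr_wpDl // => hm.
by have := le_trans hm (bound m); rewrite leNgt ltrDl ltr01.
Qed.

End Bounded.

Theorem theorem2p1 (k : fieldType) (R : realType) (v : nonarch_abs k R)
    (hcomplete : complete_abs v)
    (sA : comAlgType (ok v))
    (hsub : injective (fun c : ok v => c%:A : sA))
    (hfg : fin_gen_alg sA)
    (A : comAlgType k) (phi : {rmorphism sA -> A})
    (hA : is_base_change phi) :
  forall alpha : A,
    integralOver phi alpha <->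
    (forall s : A -> R, berkovich_point v s ->
       (forall a : sA, s (phi a) <= 1) -> s alpha <= 1).
Proof.
move=> al; split=> [int s sP s1|hs]; first exact: (integral_bounded sP s1 int).
apply: contrapT => nint; have [phiZ Adiv _] := hA.
have [c0 [a0 [c00 alE]]] := Adiv al; pose pi : k := okval c0.
(* If |pi| = 1 then pi is a unit of o_k and al already comes from sA; this settles in particular the
   trivial absolute value. *)
have vpi : v pi < 1.
  have := okvalP c0; rewrite unfold_in /= -/pi le_eqVlt => /predU1P[vpi1|//].
  case: nint; have h : pi^-1 \in ok_pred v by rewrite unfold_in /= nabsV vpi1 invr1.
  have -> : al = phi (Ok h *: a0) by rewrite phiZ -alE scalerA /= mulVf // scale1r.
  exact: integral_id.
pose M z := exists2 p : {poly sA}, p \is monic & z = (map_poly phi p).[al].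
have [|||K [f fM]] := @prime_residue_field A M.
- by exists 1; rewrite ?monic1 // rmorph1 hornerC.
- by move=> _ _ [p pm ->] [q qm ->]; exists (p * q); rewrite ?monicMl // rmorphM hornerM.
- by move=> [p pm p0]; apply: nint; exists p => //; apply/rootP.
pose io : {rmorphism k -> K} := f \o in_alg A.
have ioE a : io a = f a%:A by [].
have fal0 : f al != 0 by apply: fM; exists 'X; rewrite ?monicX // map_polyX hornerX.
pose be := (f al)^-1.
have fZ a y : f (a *: y) = io a * f y by rewrite ioE -rmorphM mulr_algl.
have [|||D DE] := @subringP K (fun z => exists a, z = f (phi a)).
- by exists 1; rewrite !rmorph1.
- by move=> _ _ [a ->] [b ->]; exists (a - b); rewrite !rmorphB.
- by move=> _ _ [a ->] [b ->]; exists (a * b); rewrite !rmorphM.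
(* Y shows that be generates a proper ideal of C. Without such a Y, [f al] would be integral over D,
   and lifting its equation to sA would contradict the choice of f. *)
have [Y [DY alY]] : exists Y : valring K, {subset D <= Y} /\ f al \notin Y.
  apply: contrapT => nY; have [|p [pm pD pal]] := @cl_ring_monic K D (f al).
    by move=> Y DY; apply: contrapT => /negP alY; apply: nY; exists Y.
  have /choice[h hE] : forall i, exists a, p`_i = f (phi a).
    by move=> i; apply/DE/(polyOverP pD).
  pose n := (size p).-1.
  have sp : size p = n.+1 by rewrite prednK // size_poly_gt0 monic_neq0.
  (* The leading term is put in by hand, because a lift of the leading coefficient is only known to
     map to 1 in K. *)
  pose q : {poly sA} := 'X^n + \poly_(i < n) h i.
  have qm : q \is monic.
    by rewrite monicE lead_coefDl ?lead_coefXn // size_polyXn ltnS size_poly.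
  have := fM _ (ex_intro2 _ _ q qm erefl); rewrite -horner_map /=.
  suff -> : map_poly f (map_poly phi q) = p by rewrite pal eqxx.
  apply/polyP => i; rewrite !coef_map coefD coefXn coef_poly /=.
  case: (ltngtP i n) => hi.
  - by rewrite add0r hE.
  - by rewrite addr0 !rmorph0 nth_default // sp.
  - by rewrite addr0 hi !rmorph1 -(monicP pm) lead_coefE sp.
pose C : subringClosed K :=
  GRing.SubringClosed.clone K (genr (fun z => z \in D \/ z = be)) _.
have DC : {subset D <= C} by move=> z zD; apply: mem_gen; left.
have beC : be \in C by apply: mem_gen; right.
have mYbe : mx Y be by rewrite /mx invrK alY orbT.
have CY : {subset C <= Y} by apply: gen_sub => z [/DY|->] //; apply: mx_in.
have phiC a : f (phi a) \in C by apply/DC/DE; exists a.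
have okC a : v a <= 1 -> io a \in C.
  move=> va; have aok : a \in ok_pred v by [].
  have -> : io a = f (phi (Ok aok *: 1)) by rewrite phiZ rmorph1.
  exact: phiC.
pose c := f (phi a0).
have becE : be * c = io pi by rewrite /c -alE fZ mulrCA mulVf ?mulr1.
have cC : c \in C by apply: phiC.
have [||||Q [Qprime JQ QM Qmin]] := @prime_avoid K C
  (fun z => exists2 y, y \in C & z = be * y) (fun z => z = 1) _ erefl.
- split.
  + by exists 0; rewrite ?rpred0 // mulr0.
  + by move=> _ [y yC ->]; rewrite rpredM.
  + by move=> _ _ [y yC ->] [z zC ->]; exists (y + z); rewrite ?rpredD // mulrDr.
  + by move=> a _ aC [y yC ->]; exists (a * y); rewrite ?rpredM // mulrCA.
- by move=> x ->; rewrite rpred1.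
- by move=> x y -> ->; rewrite mulr1.
- move=> x -> [y yC e]; have : mx Y 1 by rewrite e; apply: mxMr => //; apply: CY.
  by rewrite mx1.
have [V [CV VQ]] := dominate_prime Qprime.
have mbe : mx V be by apply/VQ => //; apply: JQ; exists 1; rewrite ?rpred1 ?mulr1.
have iopi0 : io pi != 0 by rewrite fmorph_eq0.
(* If |a| > 1 and a were in V, then 1/pi, a power of a times an element of o_k, would be in V,
   although be divides pi. *)
have kV a : io a \in V <-> v a <= 1.
  split=> [aV|/okC/CV //]; rewrite leNgt; apply/negP => va.
  have a0' : a != 0 by apply: contraTneq va => ->; rewrite (nabs_eq0 v 0).2 // ltr10.
  have [|l hl] := @exp_small R (v a^-1) (v pi) (nabs_ge0 v _) _ (nabs_gt0 v c00).
    by rewrite nabsV invf_lt1 // nabs_gt0.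
  have mpi : mx V (io pi) by rewrite -becE; apply: mxMr => //; apply: CV.
  have : (io pi)^-1 \in V; last by move: mpi; rewrite /mx (negbTE iopi0) /= => /negbTE->.
  have -> : (io pi)^-1 = io a ^+ l * io (a^-1 ^+ l / pi).
    rewrite fmorph_div rmorphXn mulrA -exprMn -rmorphM divff // rmorph1 expr1n mul1r //.
  apply: rpredM; first exact: rpredX.
  by apply/CV/okC; rewrite nabsM nabsX [v pi^-1]nabsV ler_pdivrMr ?mul1r // nabs_gt0.
have [[m hm]|hinf] := pselect (exists m, be ^+ m / io pi \in V); last first.
  have [sg hsg] := hfg; pose xs := be :: map (fun a => f (phi a)) sg.
  have xsC : {subset xs <= C}.
    by move=> z; rewrite inE => /predU1P[->//|/mapP[a _ ->]].
  apply: (@not_infinitesimal k K R v io V C CV okC _ be c pi c00 mbe becE _ cC xs xsC).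
  - by move=> a /kV.
  - by move=> l; apply/negP => h; apply: hinf; exists l.
  - move=> z zC; move: z zC; apply: gen_sub => z [/DE[a ->]|->]; last first.
      by apply: mem_gen; right; rewrite inE eqxx.
    move: a; apply: hsg => [|a asg|a b ha hb|a b ha hb|e a ha].
    + by rewrite !rmorph1 rpred1.
    + apply: mem_gen; right; rewrite inE; apply/orP; right.
      exact: (map_f (fun a => f (phi a)) asg).
    + by rewrite !rmorphD rpredD.
    + by rewrite !rmorphM rpredM.
    + rewrite phiZ fZ rpredM //; apply: mem_gen; left; exists (okval e) => //.
      exact: (okvalP e).
  - move=> g gC /(VQ _ gC)/Qmin[u [n [uC nQu [y yC e]]]].
    exists u, n, y; split=> //; apply/negP => /(VQ _ uC); exact: nQu.
have bd y : bounded_elt io V (f y).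
  have [d [a [d0 dE]]] := Adiv y; exists (okval d); split=> //.
  by rewrite -fZ dE; apply/CV/phiC.
pose s y := seminorm v io V (f y).
have : s al <= 1.
  apply: hs => [|a]; last by apply/seminorm_vring/CV/phiC.
  split.
  - by move=> x; apply: seminorm_ge0.
  - by move=> x y; rewrite /s rmorphD; apply: seminormD.
  - by move=> x y; rewrite /s rmorphM; apply: (seminormM kV c00 vpi).
  - by move=> a; apply: (seminorm_base kV).
(* Now 1/pi is an element of V times [al ^+ m], so its seminorm would be at most 1, while it equals
   1/|pi|. *)
move=> sal; have bu := bounded_vring io hm.
have sX n : seminorm v io V (f al ^+ n) <= 1.
  elim: n => [|n IHn]; first by rewrite expr0; apply: seminorm_vring; apply: rpred1.
  rewrite exprS (seminormM kV c00 vpi) //; last by rewrite -rmorphXn.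
  by apply: mulr_ile1 => //; apply: seminorm_ge0; rewrite -?rmorphXn.
have e : be ^+ m / io pi * f al ^+ m = io pi^-1.
  by rewrite fmorphV mulrAC -exprMn mulVf // expr1n mul1r.
have : v pi^-1 <= 1.
  rewrite -(seminorm_base kV) -e (seminormM kV c00 vpi) //; last by rewrite -rmorphXn.
  apply: mulr_ile1 => //; [exact: seminorm_ge0| |exact: seminorm_vring].
  by apply: seminorm_ge0; rewrite -rmorphXn.
by apply/negP; rewrite -ltNge nabsV invf_gt1 // nabs_gt0.
Qed.
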